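(* Let $\Pi$ and $\Pi'$ be polar spaces of type $\mathsf{D}_n$ and $\mathsf{D}_{n'}$, respectively, and let $\delta,\gamma\in\{+,-\}$. If $n$ is an even integer not less than $6$, then every isometric embedding of $\Gamma_\delta(\Pi)$ in $\Gamma_\gamma(\Pi')$ is induced by a frame preserving mapping of $\Pi$ to $\Pi'_M$, where $M$ is some $(n'-n-1)$-dimensional singular subspace of $\Pi'$.
   Context: Partial linear spaces. A partial linear space is a pair $\Pi=(P,\mathcal{L})$, where $P$ is a non-empty set of points and $\mathcal{L}$ is a family of proper subsets of $P$ (lines), such that every line contains at least two points, every point lies on a line, and any two distinct collinear points $p,q$ lie on exactly one line $pq$ (points are collinear if some line contains all of them). A subspace is a subset $S\subset P$ containing the line $pq$ for all distinct collinear $p,q\in S$. A subspace is singular if any two of its distinct points are collinear (the empty set and single points are singular). $\langle X\rangle$ is the smallest subspace containing $X$. $X$ is independent if $\langle X\rangle$ is not spanned by a proper subset of $X$; a base of a subspace $S$ is an independent subset spanning $S$; $\dim S$ is the smallest cardinality $\alpha$ such that $S$ has a base of cardinality $\alpha+1$ (so $\dim\emptyset=-1$, points have dimension $0$, lines dimension $1$). Polar spaces. A polar space is a partial linear space $\Pi=(P,\mathcal L)$ such that: every line contains at least three points; no point is collinear to all points; if $p\in P$, $L\in\mathcal L$, then $p$ is collinear to one or all points of $L$; any flag of singular subspaces is finite. It has rank $n$ if its maximal singular subspaces have dimension $n-1$. It is of type $\mathsf{D}_n$ if it has rank $n$ and every $(n-2)$-dimensional singular subspace is contained in precisely two maximal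 singular subspaces. $p\perp q$ means that $p$ and $q$ are collinear. $\mathcal G_k(\Pi)$ is the set of $k$-dimensional singular subspaces. Ranks of polar spaces of type $\mathsf D$ whose half-spin Grassmann graphs are considered are assumed to be at least $4$ (so $n'\ge 4$). Dual polar and half-spin graphs. The dual polar graph $\Gamma_{n-1}(\Pi)$ has vertex set $\mathcal G_{n-1}(\Pi)$, two elements being adjacent if their intersection is $(n-2)$-dimensional; its distance is $d(S,U)=n-1-\dim(S\cap U)$. If $\Pi$ is of type $\mathsf D_n$, then $\mathcal G_{n-1}(\Pi)$ decomposes uniquely (up to naming) into two disjoint subsets $\mathcal G_+(\Pi)$, $\mathcal G_-(\Pi)$ (half-spin Grassmannians) such that $d$ is even within each of them and odd between them. The half-spin Grassmann graph $\Gamma_\delta(\Pi)$, $\delta\in\{+,-\}$, has vertex set $\mathcal G_\delta(\Pi)$, two elements being adjacent if their intersection is $(n-3)$-dimensional (i.e. $d=2$). Isometric embeddings. An embedding of a graph $\Gamma$ in a graph $\Gamma'$ is an injective map of vertex sets sending adjacent vertices to adjacent vertices and non-adjacent vertices to non-adjacent ones; it is isometric if it preserves the (path) distance. Residues. Let $M$ be an $(n'-n-1)$-dimensional singular subspace of $\Pi'$ (with $n\le n'$). $\Pi'_M$ denotes the polar space of rank $n$ whose points are the elements of $\mathcal G_{n'-n}(\Pi')$ containing $M$ and whose lines are the sets of all $X\in\mathcal G_{n'-n}(\Pi')$ with $M\subset X\subset N$, for $N\in\mathcal G_{n'-n+1}(\Pi')$ containing $M$. Its maximal singular subspaces are the sets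 $[M,U]_{n'-n}=\{X\in\mathcal G_{n'-n}(\Pi'): M\subset X\subset U\}$ with $U\in\mathcal G_{n'-1}(\Pi')$ containing $M$; $[M,U]_{n'-n}$ is identified with $U$. If $n=n'$, then $M=\emptyset$ and $\Pi'_M=\Pi'$. Frame preserving mappings. A frame of a polar space of rank $n$ is a set of $2n$ distinct points $p_1,\dots,p_{2n}$ such that for every $i$ there is a unique $\sigma(i)\in\{1,\dots,2n\}$ with $p_i\not\perp p_{\sigma(i)}$. A mapping $g$ from the point set of $\Pi$ to the point set of $\Pi'_M$ is frame preserving if it transfers every frame of $\Pi$ to a frame of $\Pi'_M$. For such $g$ and every $X\in\mathcal G_{n-1}(\Pi)$ the span $\langle g(X)\rangle$ in $\Pi'_M$ is a maximal singular subspace of $\Pi'_M$. A mapping $f:\mathcal G_\delta(\Pi)\to\mathcal G_\gamma(\Pi')$ is induced by $g$ if $f(X)=\langle g(X)\rangle$ for every $X\in\mathcal G_\delta(\Pi)$ under the identification of each maximal singular subspace $[M,U]_{n'-n}$ of $\Pi'_M$ with the element $U\in\mathcal G_{n'-1}(\Pi')$ containing $M$, i.e. $M\subset f(X)$ and $[M,f(X)]_{n'-n}=\langle g(X)\rangle$. *)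

(* Defs.v *)
From mathcomp Require Import all_boot all_order ssralg ssrint.
From mathcomp Require Import boolp classical_sets functions cardinality.

Set Implicit Arguments.
Unset Strict Implicit.
Unset Printing Implicit Defensive.

Local Open Scope classical_set_scope.
Local Open Scope card_scope.
Local Open Scope ring_scope.

(* The points are a subset of the carrier type, rather than the whole type, so
   that the residues below (whose points are certain subsets of another space)
   are again point-line spaces. *)
Record point_line_space (T : Type) := PointLineSpace {
  points : set T;
  lines : set (set T)
}.

Section PartialLinearSpaces.
Variables (T : Type) (Pi : point_line_space T).
Implicit Types (p q : T) (L S U X Y B : set T).

Definition collinear p q := exists L, [/\ lines Pi L, L p & L q].

Definition partial_linear_space :=
  [/\ points Pi !=set0,
      forall L, lines Pi L -> L `<` points Pi /\ `I_2 #<= L,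
      forall p, points Pi p -> exists2 L, lines Pi L & L p
    & forall p q, p <> q -> collinear p q ->
        exists! L, [/\ lines Pi L, L p & L q]].

Definition subspace S :=
  S `<=` points Pi /\
  forall p q L, S p -> S q -> p <> q -> lines Pi L -> L p -> L q -> L `<=` S.

Definition singular S :=
  subspace S /\ forall p q, S p -> S q -> p <> q -> collinear p q.

Definition spanned X : set T := smallest subspace X.

Definition independent X :=
  X `<=` points Pi /\ forall Y, Y `<` X -> spanned Y <> spanned X.

Definition base B S := independent B /\ spanned B = S.

(* dim S = k; in particular the empty subspace has dimension -1, and no S has
   dimension k when k < -1. *)
Definition has_dim S (k : int) := exists (m : nat) B,
  [/\ m%:Z = k + 1, base B S, B #= `I_m & forall B', base B' S -> B #<= B'].

Definition Gr (k : int) : set (set T) :=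
  [set S | singular S /\ has_dim S k].

Definition maximal_singular S :=
  singular S /\ forall U, singular U -> S `<=` U -> U = S.

Definition polar_space :=
  [/\ partial_linear_space,
      forall L, lines Pi L -> `I_3 #<= L,
      forall p, points Pi p -> exists2 q, points Pi q & ~ collinear p q,
      forall p L, points Pi p -> lines Pi L ->
        (exists! q, L q /\ collinear p q) \/ (forall q, L q -> collinear p q)
    & forall C : set (set T), (forall S, C S -> singular S) ->
        total_on C subset -> finite_set C].

Definition has_rank (n : nat) :=
  forall S, maximal_singular S -> has_dim S (n%:Z - 1).

Definition polar_space_of_type_D (n : nat) :=
  [/\ polar_space, has_rank n
    & forall S, Gr (n%:Z - 2) S ->
        [set U | maximal_singular U /\ S `<=` U] #= `I_2].

(* n is the rank of Pi *)
Definition frame (n : nat) : set (set T) :=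
  [set F | [/\ F `<=` points Pi, F #= `I_(2 * n)%N
             & forall p, F p -> exists! q, F q /\ ~ collinear p q]].

End PartialLinearSpaces.

Record graph (A : Type) := Graph {
  vertices : set A;
  adjacent : A -> A -> Prop
}.

Inductive walk (A : Type) (Gamma : graph A) : nat -> A -> A -> Prop :=
| walk_nil x : vertices Gamma x -> walk Gamma 0 x x
| walk_step k x y z : walk Gamma k x y -> vertices Gamma z ->
    adjacent Gamma y z -> walk Gamma k.+1 x z.

(* The path distance of x and y is k; it holds for no k when x and y lie in
   different connected components. *)
Definition has_distance (A : Type) (Gamma : graph A) (x y : A) (k : nat) :=
  walk Gamma k x y /\ forall j, walk Gamma j x y -> (k <= j)%N.

(* A map of vertex sets is a function on the carrier types, of which only the
   values at vertices matter. *)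
Definition embedding (A A' : Type) (Gamma : graph A) (Gamma' : graph A')
    (f : A -> A') :=
  [/\ forall x, vertices Gamma x -> vertices Gamma' (f x),
      forall x y, vertices Gamma x -> vertices Gamma y -> f x = f y -> x = y
    & forall x y, vertices Gamma x -> vertices Gamma y ->
        (adjacent Gamma x y <-> adjacent Gamma' (f x) (f y))].

Definition isometric_embedding (A A' : Type) (Gamma : graph A)
    (Gamma' : graph A') (f : A -> A') :=
  embedding Gamma Gamma' f /\
  forall x y k, vertices Gamma x -> vertices Gamma y ->
    (has_distance Gamma x y k <-> has_distance Gamma' (f x) (f y) k).

Section Grassmannians.
Variables (T : Type) (Pi : point_line_space T) (n : nat).

Definition dual_polar_graph : graph (set T) :=
  Graph (Gr Pi (n%:Z - 1)) (fun S U => Gr Pi (n%:Z - 2) (S `&` U)).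

(* The two half-spin Grassmannians G true and G false are determined by Pi only
   up to exchanging them. *)
Definition half_spin_Grassmannians (G : bool -> set (set T)) :=
  [/\ G true `|` G false = Gr Pi (n%:Z - 1),
      G true `&` G false = set0
    & forall (b c : bool) S U, G b S -> G c U ->
        exists2 k, has_distance dual_polar_graph S U k & odd k = (b != c)].

(* Gdelta is one of the two half-spin Grassmannians *)
Definition half_spin_graph (Gdelta : set (set T)) : graph (set T) :=
  Graph Gdelta (fun S U => Gr Pi (n%:Z - 3) (S `&` U)).

End Grassmannians.

Definition interval (T : Type) (Pi : point_line_space T) (k : int)
    (M N : set T) : set (set T) :=
  [set X | [/\ Gr Pi k X, M `<=` X & X `<=` N]].

(* For M of dimension k - 1. When M is empty and k = 0, the points of the
   residue are the singletons [set p], identified with the points p of Pi. *)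
Definition residue (T : Type) (Pi : point_line_space T) (k : int) (M : set T) :
    point_line_space (set T) :=
  PointLineSpace [set X | Gr Pi k X /\ M `<=` X]
    [set interval Pi k M N | N in [set N | Gr Pi (k + 1) N /\ M `<=` N]].

(* n is the common rank of Pi and Pi' *)
Definition frame_preserving (T T' : Type) (n : nat) (Pi : point_line_space T)
    (Pi' : point_line_space T') (g : T -> T') :=
  (forall p, points Pi p -> points Pi' (g p)) /\
  forall F, frame Pi n F -> frame Pi' n (g @` F).

(* f, defined on Gdelta, is induced by the map g from the points of the source
   space to the points of residue Pi' k M. *)
Definition induced_by (T T' : Type) (Gdelta : set (set T))
    (Pi' : point_line_space T') (k : int) (M : set T')
    (f : set T -> set T') (g : T -> set T') :=
  forall X, Gdelta X ->
    M `<=` f X /\ interval Pi' k M (f X) = spanned (residue Pi' k M) (g @` X).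

(* Main.v *)
Require Import Defs.
From mathcomp Require Import all_boot all_order ssralg ssrint.
From mathcomp Require Import boolp classical_sets functions cardinality.
From mathcomp Require Import zify.

(** Half-spin distance is half of the distance n - rk (X & Y) of the dual polar
    graph, so f keeps the latter on G delta.

    Step one extends f to an isometric embedding F of the whole dual polar graph.
    An element U of the other class is seen inside G delta as the clique of its
    neighbours, and the image of this clique consists of neighbours of one U'
    (clique_neighbour). A clique could also be mapped to one of the other kind,
    in which all members share a subspace of corank 3 and which looks like a
    projective space of dimension 3; from rank 6 on, the distances to further
    vertices exclude this. The extension F keeps adjacency, so it does not
    increase distances. As n is even, an element of G delta is not opposite to
    any element of the other class; so a pair with exactly one member in
    G delta lies on a geodesic with both ends in G delta and keeps its distance.
    Pairs outside G delta follow (extension_isometric), of which the opposite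
    ones need an argument of their own.

    Step two reads off the point map. In type D adjacent vertices are never
    equally far from a third one (dist_closer, dist_farther), since only two maximal
    singular subspaces pass through a common hyperplane. Therefore a
    geodesically closed set that contains X and Y contains everything through
    X & Y (convex_through), and since intersections are geodesically convex
    (dist_convex), F X & F Y lies in F W whenever X & Y lies in W. Opposite X and Y
    give one subspace M, contained in all images, and X and Y meeting in a point
    p give the image g p of p, of rank one more than M. The map g keeps
    collinearity and non-collinearity, hence frames, and along a flag of X the
    ranks of the intersections F X & F Y grow by one at each step, so the g x
    with x in X span F X.

    Underneath lies the dimension theory of singular subspaces. They are
    iterated cones over points, and a cone over a singular subspace is a double
    perp (cone_biperp), which yields exchange, hyperplanes and the modular
    law. *)

Set Implicit Arguments.
Unset Strict Implicit.
Unset Printing Implicit Defensive.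

Local Open Scope classical_set_scope.
Local Open Scope card_scope.

(** * Polar spaces of finite rank and of type D *)

Record polar_geometry (T : Type) (n : nat) := PolarGeometry {
  space :> point_line_space T;
  space_polar : polar_space space;
  space_rank : has_rank space n
}.

Record thin_polar_geometry (T : Type) (n : nat) := ThinPolarGeometry {
  geometry :> polar_geometry T n;
  geometry_thin : forall S, Gr geometry (n%:Z - 2)%R S ->
    [set U | maximal_singular geometry U /\ S `<=` U] #= `I_2
}.

(** * Singular subspaces as iterated cones *)

Section PolarSpace.
Context {T : Type} {n : nat} (Pi : polar_geometry T n).

Local Notation polarPi := (@space_polar T n Pi).
Local Notation rankPi := (@space_rank T n Pi).
Local Notation pt := (points Pi).
Local Notation col := (collinear Pi).
Local Notation sing := (singular Pi).

Lemma line_pt L p : lines Pi L -> L p -> pt p.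
Proof. by have [[_ h _ _] _ _ _ _] := polarPi; move=> /h [[h1 _] _] /h1. Qed.

Lemma col_pt p q : col p q -> pt p /\ pt q.
Proof. by move=> [L [lL Lp Lq]]; split; apply: line_pt lL _. Qed.

Lemma col_sym p q : col p q -> col q p.
Proof. by move=> [L [lL Lp Lq]]; exists L. Qed.

Lemma col_refl p : pt p -> col p p.
Proof.
have [[_ _ h _] _ _ _ _] := polarPi.
by move=> /h [L lL Lp]; exists L.
Qed.

(** The one-or-all axiom, in the form in which it is used: perps are subspaces. *)
Lemma col_line x p q r L : p <> q -> lines Pi L -> L p -> L q -> L r ->
  col x p -> col x q -> col x r.
Proof.
have [_ _ _ h _] := polarPi.
move=> pq lL Lp Lq Lr xp xq.
have [ptx _] := col_pt xp.
case: (h x L ptx lL) => [[y [_ uy]]|]; last exact.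
by case: pq; rewrite -(uy p)// -(uy q).
Qed.

Lemma meet_line x L : pt x -> lines Pi L -> exists2 q, L q & col x q.
Proof.
have [[_ hL _ _] _ _ h _] := polarPi.
move=> ptx lL; case: (h x L ptx lL) => [[y [[Ly xy] _]]|al]; first by exists y.
have [L0|/set0P[q Lq]] := eqVneq L set0; last by exists q => //; apply: al.
have [_] := hL L lL; rewrite L0 card_le0 => /eqP I0.
by have : set0 (0 : nat) by rewrite -I0.
Qed.

Lemma not_col p : pt p -> exists2 q, pt q & ~ col p q.
Proof. by have [_ _ h _ _] := polarPi; apply: h. Qed.

Lemma sing_pt A x : sing A -> A x -> pt x.
Proof. by move=> [[h _] _] /h. Qed.

Lemma sing_col A x y : sing A -> A x -> A y -> col x y.
Proof.
move=> sA Ax Ay; have [->|xy] := pselect (x = y).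
  by apply: col_refl; apply: sing_pt sA Ay.
by case: sA => _; apply.
Qed.

Definition perp (A : set T) : set T :=
  [set z | pt z /\ forall x, A x -> col x z].

Lemma perp_subspace A : subspace Pi (perp A).
Proof.
split=> [z []//|p q L [ptp hp] [ptq hq] pq lL Lp Lq r Lr].
split; first exact: line_pt lL Lr.
by move=> x Ax; apply: (col_line pq lL Lp Lq Lr); [apply: hp|apply: hq].
Qed.

Lemma perpS A B : A `<=` B -> perp B `<=` perp A.
Proof. by move=> AB z [ptz h]; split=> // x /AB /h. Qed.

Lemma perp_sub_biperp A : A `<=` pt -> A `<=` perp (perp A).
Proof. by move=> Apt a Aa; split; [exact: Apt|move=> z [_ /(_ _ Aa)/col_sym]].
  Qed.

Lemma sing_perp A : sing A -> A `<=` perp A.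
Proof.
by move=> sA a Aa; split; [apply: sing_pt sA Aa|move=> x Ax;
  apply: sing_col sA _ _].
Qed.

Lemma biperp_sing A : A `<=` perp A -> sing (perp (perp A)).
Proof.
move=> AA; split; first exact: perp_subspace.
move=> p q bp bq _.
have : perp (perp (perp A)) q.
  by apply: perp_sub_biperp; [move=> ? []|apply: perpS AA _ bq].
by case=> _; apply.
Qed.

(** The span of p and A, when A is a singular subspace and p is collinear to
    all of A but not in it. *)
Definition cone p (A : set T) : set T :=
  [set r | r = p \/ exists a L, [/\ A a, lines Pi L, L p, L a & L r]].

Lemma cone_p p A : cone p A p. Proof. by left. Qed.

Lemma cone_sub p A : perp A p -> A `<=` cone p A.
Proof. by move=> [_ h] a Aa; right; have [L [lL La Lp]] := h a Aa;
  exists a, L. Qed.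

Lemma cone_min p A S : subspace Pi S -> A `<=` S -> S p -> ~ A p ->
  cone p A `<=` S.
Proof.
move=> [_ h] AS Sp nAp r [->//|[a [L [Aa lL Lp La Lr]]]].
apply: (h p a L Sp (AS _ Aa) _ lL Lp La _ Lr).
by move=> e; apply: nAp; rewrite e.
Qed.

(** That cones are subspaces (the Veblen-Young axiom) and that singular
    subspaces are intersections of perps are proved in one stroke, by showing
    that the cone is a double perp. Given r in the double perp, a point z
    collinear to A but not to p is collinear to one point x of the line r p; were
    x not in A, some q collinear to A would not be collinear to x. On the line
    z q a point collinear to p would be collinear to r, hence to x, and then so
    would be q. *)
Lemma cone_biperp A p : sing A -> perp (perp A) `<=` A -> perp A p -> ~ A p ->
  cone p A = perp (perp (A `|` [set p])).
Proof.
move=> sA cA pA nAp.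
have ptAp : A `|` [set p] `<=` pt.
  by move=> x [/(sing_pt sA)//|->]; case: pA.
apply/seteqP; split.
  apply: cone_min nAp; first exact: perp_subspace.
    by move=> a Aa; apply: perp_sub_biperp => //; left.
  by apply: perp_sub_biperp => //; right.
move=> r br.
have [->|rp] := pselect (r = p); first by left.
have hz z : perp A z -> col p z -> col r z.
  move=> [ptz zA] zp; apply: col_sym; case: br => _; apply;
    split=> // x [/zA//|->//].
have pr : col r p by apply: hz => //; apply: col_refl; case: pA.
have [L [lL Lr Lp]] := pr.
have ptp : pt p by case: pA.
have rA a : A a -> col a r.
  move=> Aa; apply: col_sym; apply: hz; first exact: (sing_perp sA).
  by case: pA => _ /(_ _ Aa)/col_sym.
right.
have [z zA zp] : exists2 z, perp A z & ~ col p z.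
  apply: contra_notP nAp => H; apply: cA; split=> // z zA.
  by apply: col_sym; apply: contra_notP H => zp; exists z.
have [x Lx zx] := meet_line (proj1 zA) lL.
exists x, L; split=> //.
apply: contrapT => nAx.
have ptx := line_pt lL Lx.
have [q qA qx] : exists2 q, perp A q & ~ col q x.
  apply: contra_notP nAx => H; apply: cA; split=> // q qA.
  by apply: contra_notP H => qx; exists q.
have px y : col y p -> perp A y -> col y x.
  move=> yp yA; apply: (col_line rp lL Lr Lp Lx _ yp).
  by apply: col_sym; apply: hz => //; apply: col_sym.
have xA : perp A x.
  have := perp_subspace A => -[_]; apply;
    [|exact: pA|exact: rp|exact: lL|exact: Lr|exact: Lp|exact: Lx].
  by split; [apply: line_pt lL Lr|exact: rA].
(* if the separating points w and q lie on a line, the point of that line that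
   is collinear to p makes the whole line collinear to x *)
have key w : perp A w -> ~ col p w -> col w x -> ~ col q w.
  move=> wA wp wx [K [lK Kq Kw]].
  have [t Kt pt_] := meet_line ptp lK.
  have tw : t <> w by move=> e; apply: wp; rewrite -e.
  have qw : q <> w by move=> e; apply: qx; rewrite e.
  have tA : perp A t.
    have := perp_subspace A => -[_ /(_ q w K qA wA qw lK Kq Kw)]; exact.
  apply: qx; apply: col_sym; apply: (col_line tw lK Kt Kw Kq);
    apply: col_sym => //.
  by apply: px => //; apply: col_sym.
have [qz|qz] := pselect (col q z); first exact: key zA zp zx qz.
have zx' : z <> x by move=> e; apply: zp; rewrite e; exists L.
have [K [lK Kz Kx]] := zx.
(* z is replaced by a point of the line z x that is collinear to q *)
have [s Ks qs] := meet_line (proj1 qA) lK.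
have sx : s <> x by move=> e; apply: qx; rewrite -e.
have sA' : perp A s.
  have := perp_subspace A => -[_ /(_ z x K zA xA zx' lK Kz Kx)]; exact.
apply: (key s) => //; last by exists K.
move=> ps; apply: zp.
by apply: (col_line sx lK Ks Kx Kz ps); exists L.
Qed.

(** * Rank *)

(** Rank is vector space dimension, one more than projective dimension; cones
    raise it by one. *)
Inductive rank : set T -> nat -> Prop :=
| rank0 : rank set0 0
| rankS A p m : rank A m -> perp A p -> ~ A p -> rank (cone p A) m.+1.

Lemma rank_sing A m : rank A m -> sing A /\ perp (perp A) `<=` A.
Proof.
elim=> [|{m}B p m _ [sB cB] pB nBp].
  split; first by split; [split=> // ? ? ? []|].
  move=> x [ptx h]; have [y pty xy] := not_col ptx; case: xy.
  by apply/col_sym/h; split.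
have BpB : B `|` [set p] `<=` perp (B `|` [set p]).
  move=> x Bx; split; first by case: Bx => [/(sing_pt sB)//|->]; case: pB.
  move=> y; case: Bx => [Bx|->] [By|->].
  - exact: sing_col sB By Bx.
  - by apply: col_sym; case: pB => _; apply.
  - by case: pB => _; apply.
  - by apply: col_refl; case: pB.
rewrite cone_biperp //; split; first exact: biperp_sing.
by apply: perpS; apply: perp_sub_biperp => x [].
Qed.

Lemma cone_sing A m p : rank A m -> perp A p -> ~ A p -> sing (cone p A).
Proof. by move=> rA pA nAp; have [] := rank_sing (rankS rA pA nAp). Qed.

Lemma sub_sing A B : subspace Pi A -> sing B -> A `<=` B -> sing A.
Proof. by move=> uA [_ cB] AB; split=> // p q /AB Ap /AB Aq; apply: cB. Qed.

Lemma cone_exchange A m p q : rank A m -> perp A p -> ~ A p ->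
  cone p A q -> ~ A q -> cone q A = cone p A.
Proof.
move=> rA pA nAp pq nAq.
have sp := cone_sing rA pA nAp.
have qA : perp A q.
  split; first exact: sing_pt sp pq.
  by move=> x /(cone_sub pA) px; apply: sing_col sp px pq.
have sq := cone_sing rA qA nAq.
have qp : cone q A p.
  by case: pq => [->|[a [L [Aa lL Lp La Lq]]]]; [left|right; exists a, L].
apply/seteqP; split.
  by apply: cone_min nAq => //; [case: sp|apply: cone_sub].
by apply: cone_min nAp => //; [case: sq|apply: cone_sub].
Qed.

(** A is cut out of cone p A by the perp of any z that is collinear to A but not
    to p, and the perp of a point meets every line. *)
Lemma cone_line_meet A m p L : rank A m -> perp A p -> ~ A p -> lines Pi L ->
  L `<=` cone p A -> exists2 h, L h & A h.
Proof.
move=> rA pA nAp lL Lp.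
have [_ cA] := rank_sing rA.
have [z zA zp] : exists2 z, perp A z & ~ col z p.
  apply: contra_notP nAp => H; apply: cA; split; first by case: pA.
  by move=> z zA; apply: contra_notP H => zp; exists z.
have [h Lh zh] := meet_line (proj1 zA) lL.
exists h => //; case: (Lp _ Lh) => [e|[a [K [Aa lK Kp Ka Kh]]]].
  by case: zp; rewrite -e.
have [->//|ha] := pselect (h = a); case: zp.
by apply: (col_line ha lK Kh Ka Kp zh); apply: col_sym; apply (proj2 zA).
Qed.

Lemma sing_line S x y : sing S -> S x -> S y -> x <> y ->
  exists L, [/\ lines Pi L, L x, L y & L `<=` S].
Proof.
move=> sS Sx Sy xy; have [L [lL Lx Ly]] := sing_col sS Sx Sy.
by exists L; split=> //; case: sS => -[_ /(_ x y L Sx Sy xy lL Lx Ly)].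
Qed.

Lemma subspace_line S x y L z : subspace Pi S -> S x -> S y -> x <> y ->
  lines Pi L -> L x -> L y -> L z -> S z.
Proof. by move=> [_ h] Sx Sy xy lL Lx Ly Lz; apply: (h x y L). Qed.

Lemma subspaceI A B : subspace Pi A -> subspace Pi B -> subspace Pi (A `&` B).
Proof.
move=> [A1 A2] [B1 B2]; split=> [x [/A1]//|p q L [Ap Bp] [Aq Bq] pq lL Lp Lq z
  Lz].
by split; [apply: (A2 p q L)|apply: (B2 p q L)].
Qed.

(** Induction along the cones that build S = cone q A: if A is not in H, then
    A and H both cover A & H, which is a hyperplane of A. This gives at once
    that the rank is well defined. *)
Lemma rank_hyperplane S m H x : rank S m -> subspace Pi H -> H `<=` S ->
  (forall L, lines Pi L -> L `<=` S -> exists2 h, L h & H h) ->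
  S x -> ~ H x -> exists2 k, m = k.+1 & rank H k.
Proof.
move=> rS; elim: rS H x => {S m} [//|A q m rA IH qA nAq] H x uH HS mH Sx nHx.
have sS := cone_sing rA qA nAq.
have qq : cone q A q := cone_p q A.
have AS := cone_sub qA.
have [AH|/existsNP[a /not_implyP[Aa nHa]]] := pselect (A `<=` H).
  exists m => //; suff -> : H = A by [].
  apply/seteqP; split=> // h Hh; apply: contrapT => nAh.
  apply: nHx; move: Sx; rewrite -(cone_exchange rA qA nAq (HS _ Hh) nAh).
  exact: (cone_min uH AH Hh nAh).
have [sA _] := rank_sing rA.
have [|||||k -> rAH] := IH (A `&` H) a.
- by apply: subspaceI; [case: sA|].
- by move=> ? [].
- move=> L lL LA; have [h Lh Hh] := mH L lL (subset_trans LA AS).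
  by exists h => //; split=> //; apply: LA.
- exact: Aa.
- by case.
exists k.+1 => //.
have aq : a <> q by move=> e; apply: nAq; rewrite -e.
have [L [lL La Lq LS]] := sing_line sS (AS _ Aa) qq aq.
have [h Lh Hh] := mH L lL LS.
have ha : h <> a by move=> e; apply: nHa; rewrite -e.
have nAh : ~ A h.
  by move=> Ah; apply: nAq; apply: (subspace_line (proj1 sA) Ah Aa ha lL).
have hAH : perp (A `&` H) h.
  split; first exact: line_pt lL Lh.
  by move=> y [/AS Ay _]; apply: sing_col sS Ay (HS _ Hh).
suff -> : H = cone h (A `&` H) by apply: rankS => // -[].
apply/seteqP; split; last first.
  by apply: cone_min => // -[].
move=> y Hy; have [->|yh] := pselect (y = h); first exact: cone_p.
have [K [lK Ky Kh KS]] := sing_line sS (HS _ Hy) (HS _ Hh) yh.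
have [b Kb Ab] := cone_line_meet rA qA nAq lK KS.
right; exists b, K; split=> //; split=> //.
exact: (subspace_line uH Hy Hh yh lK).
Qed.

Lemma rank_uniq S m m' : rank S m -> rank S m' -> m = m'.
Proof.
move=> rS; elim: rS m' => {S m} [|A q m rA IH qA nAq] m' rS'.
  case E: _ _ / rS' => [//|B p k _ _ _].
  by have : cone p B p := cone_p p B; rewrite -E.
have [k -> /IH->//] := rank_hyperplane (x := q) rS' (proj1 (proj1 (rank_sing
  rA)))
  (cone_sub qA) (fun L => cone_line_meet rA qA nAq (L:=L)) (cone_p q A) nAq.
Qed.

Lemma rank_sub S m B : rank S m -> subspace Pi B -> B `<=` S ->
  exists2 k, (k <= m)%N & rank B k.
Proof.
move=> rS; elim: rS B => {S m} [|A q m rA IH qA nAq] B uB BS.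
  by exists 0 => //; have -> : B = set0 by [apply/seteqP; split]; exact: rank0.
have [BA|/existsNP[b /not_implyP[Bb nAb]]] := pselect (B `<=` A).
  by have [k km rB] := IH B uB BA; exists k => //; apply: leqW.
have [sA _] := rank_sing rA.
have [||k km rBA] := IH (B `&` A); [by apply: subspaceI => //;
  case: sA|by move=> ? []|].
exists k.+1 => //.
have sS := cone_sing rA qA nAq.
suff -> : B = cone b (B `&` A).
  apply: rankS => // [|[]//]; split; first exact: sing_pt sS (BS _ Bb).
  by move=> x [/BS Sx _]; apply: sing_col sS Sx (BS _ Bb).
apply/seteqP; split; last by apply: cone_min => // -[].
move=> y By; have [->|yb] := pselect (y = b); first exact: cone_p.
have [K [lK Ky Kb KS]] := sing_line sS (BS _ By) (BS _ Bb) yb.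
have [c Kc Ac] := cone_line_meet rA qA nAq lK KS.
right; exists c, K; split=> //; split=> //.
exact: (subspace_line uB By Bb yb lK).
Qed.

Lemma pt_subspace : subspace Pi pt.
Proof. by split=> // p q L _ _ _ lL _ _ r; apply: line_pt. Qed.

Lemma spanned_subspace X : X `<=` pt -> subspace Pi (spanned Pi X).
Proof.
move=> Xpt; split=> [x|p q L sp sq pq lL Lp Lq r Lr S [uS XS]].
  by apply; split=> //; apply: pt_subspace.
by apply: (subspace_line uS _ _ pq lL) => //; [apply: sp|apply: sq].
Qed.

Lemma spanned_id S : subspace Pi S -> spanned Pi S = S.
Proof. by move=> uS; apply: smallest_id. Qed.

Lemma spanned_cone X x m : X `<=` pt -> rank (spanned Pi X) m ->
  perp (spanned Pi X) x -> ~ spanned Pi X x ->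
  spanned Pi (X `|` [set x]) = cone x (spanned Pi X).
Proof.
move=> Xpt rX xX nXx; apply/seteqP; split.
  apply: smallest_sub; first by case: (cone_sing rX xX nXx).
  move=> y [Xy|->]; last exact: cone_p.
  by apply: cone_sub => //; apply: sub_gen_smallest.
have Xpt' : X `|` [set x] `<=` pt by move=> y [/Xpt//|->]; case: xX.
apply: cone_min => //; first exact: spanned_subspace.
  by apply: smallest_sub; [exact: spanned_subspace|move=> y Xy S [_]; apply;
    left].
by move=> S [_]; apply; right.
Qed.

Lemma spanned_rank m X : X #= `I_m -> X `<=` perp X ->
  exists2 k, (k <= m)%N & rank (spanned Pi X) k.
Proof.
elim: m X => [|m IH] X.
  rewrite II0 card_eq0 => /eqP -> _; exists 0 => //.
  by rewrite spanned_id; [exact: rank0|case: (rank_sing rank0) => -[]].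
move=> /eq_cardSP[x Xx /IH] H XX.
have Xpt : X `<=` pt by move=> y /XX[].
have sub : X `\ x `<=` X by move=> ? [].
have [|k km rX] := H.
  by move=> y [Xy _]; apply: perpS sub _ _; apply: XX.
have eX : X = (X `\ x) `|` [set x].
  by apply/seteqP; split=> [y Xy|y [[]//|->//]]; have [->|] := pselect (y = x);
    [right|left].
have [Yx|nYx] := pselect (spanned Pi (X `\ x) x).
  exists k; first exact: leqW.
  suff -> : spanned Pi X = spanned Pi (X `\ x) by [].
  have uY : subspace Pi (spanned Pi (X `\ x)).
    by apply: spanned_subspace; apply: subset_trans Xpt.
  apply/seteqP; split; apply: smallest_sub => //.
  - by rewrite {1}eX => y [|->//]; apply: sub_gen_smallest.
  - exact: spanned_subspace.
  - by apply: subset_trans sub _; apply: sub_gen_smallest.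
have xY : perp (spanned Pi (X `\ x)) x.
  split; first exact: Xpt.
  suff h : spanned Pi (X `\ x) `<=` perp [set x].
    by move=> y /h[_ /(_ x erefl)/col_sym].
  apply: smallest_sub; first exact: perp_subspace.
  move=> y [Xy _]; split; first exact: Xpt.
  by move=> z ->; have [_] := XX _ Xy; apply.
exists k.+1 => //; rewrite eX (@spanned_cone _ _ k) //; first exact: rankS.
exact: subset_trans sub Xpt.
Qed.

Lemma rank_base S m : rank S m ->
  exists B, [/\ B `<=` S, B #= `I_m & spanned Pi B = S].
Proof.
elim=> {S m} [|A p m rA [B [BA cB eA]] pA nAp].
  exists set0; split=> //; first by rewrite II0.
  by apply: spanned_id; case: (rank_sing rank0) => -[].
exists (B `|` [set p]); split.
- by move=> x [/BA/(cone_sub pA)//|->]; apply: cone_p.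
- apply/eq_cardSP; exists p; first by right.
  suff -> : (B `|` [set p]) `\ p = B by [].
  apply/seteqP; split=> [x [[]//]|x Bx]; split; first by left.
  by move=> e; apply: nAp; rewrite -e; apply: BA.
- rewrite (@spanned_cone _ _ m) ?eA //.
  by apply: subset_trans BA _; case: (rank_sing rA) => -[[]].
Qed.

(** This is why the minimality over all bases in has_dim is automatic. *)
Lemma rank_min S m k B : rank S m -> B `<=` S -> spanned Pi B = S ->
  B #= `I_k -> (m <= k)%N.
Proof.
move=> rS BS eB cB; have [sS _] := rank_sing rS.
have [|j jk] := spanned_rank cB.
  move=> x Bx; split; first by apply: sing_pt sS (BS _ Bx).
  by move=> y By; apply: sing_col sS (BS _ By) (BS _ Bx).
by rewrite eB => /(rank_uniq rS) ->.
Qed.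

Lemma rank_has_dim S m (k : int) : rank S m -> (m%:Z = k + 1)%R ->
  has_dim Pi S k.
Proof.
move=> rS mk; have [B [BS cB eB]] := rank_base rS.
have [sS _] := rank_sing rS.
have min B' : base Pi B' S -> B #<= B'.
  move=> [[B'pt _] eB'].
  have B'S : B' `<=` S by rewrite -eB'; apply: sub_gen_smallest.
  rewrite (card_le_eql cB).
  have [/finite_setP[j cB']|/infiniteP] := pselect (finite_set B').
    by rewrite (card_le_eqr cB') card_le_II (rank_min rS B'S eB' cB').
  by apply: card_le_trans; apply: card_leT.
exists m, B; split=> //; split=> //; split; first by move=> x /BS;
  apply: sing_pt.
move=> Y [YB nBY] eY.
have fY : finite_set Y by apply: sub_finite_set YB _; apply/finite_setP;
  exists m.
have [j cY] := (iffLR (finite_setP _) fY).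
have := rank_min rS (subset_trans YB BS) (etrans eY eB) cY.
rewrite leqNgt => /negP; apply.
have [b Bb nYb] : exists2 b, B b & ~ Y b.
  by apply: contra_notP nBY => H b Bb; apply: contra_notP H => ?; exists b.
have : Y `|` [set b] #<= B by apply: subset_card_le => x [/YB//|->].
rewrite (card_le_eqr cB).
suff /card_le_eql -> : Y `|` [set b] #= `I_j.+1 by rewrite card_le_II.
apply/eq_cardSP; exists b; first by right.
suff -> : (Y `|` [set b]) `\ b = Y by [].
apply/seteqP; split=> [x [[]//]|x Yx]; split; first by left.
by move=> e; apply: nYb; rewrite -e.
Qed.

Lemma has_dim_rank S (k : int) : sing S -> has_dim Pi S k ->
  exists2 m, (m%:Z = k + 1)%R & rank S m.
Proof.
move=> sS [m [B [mk [[Bpt iB] eB] cB min]]].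
have BS : B `<=` S by rewrite -eB; apply: sub_gen_smallest.
have [|j jm rS] := spanned_rank cB.
  move=> x Bx; split; first by apply: sing_pt sS (BS _ Bx).
  by move=> y By; apply: sing_col sS (BS _ By) (BS _ Bx).
rewrite eB in rS.
have [j' [B' [j'E [bB' eB'] cB' _]]] := rank_has_dim (k := (j%:Z - 1)%R) rS
  ltac:(lia).
have jj : j' = j by lia.
have := min B' (conj bB' eB'); rewrite (card_le_eql cB) (card_le_eqr cB')
  card_le_II jj.
by move=> mj; exists m => //; have -> : m = j by lia.
Qed.

Lemma rank_full S m B : rank S m -> subspace Pi B -> B `<=` S -> rank B m ->
  B = S.
Proof.
move=> rS uB BS rB; have [sS _] := rank_sing rS.
apply/seteqP; split=> // x Sx; apply: contrapT => nBx.
have xB : perp B x.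
  by split; [apply: sing_pt sS Sx|move=> y /BS Sy; apply: sing_col sS Sy Sx].
have [|k km rk] := rank_sub rS (proj1 (cone_sing rB xB nBx)).
  by apply: cone_min => //; case: sS.
by have := rank_uniq rk (rankS rB xB nBx); lia.
Qed.

Lemma maximal_ex S : sing S -> exists2 X, maximal_singular Pi X & S `<=` X.
Proof.
move=> sS.
have [F FP tF|A [sA maxA]] := @Zorn_bigcup T [set A | sing (A `|` S)].
  have dir x y : (\bigcup_(X in F) X `|` S) x -> (\bigcup_(X in F) X `|` S) y ->
      exists2 B, sing B & [/\ B x, B y & B `<=` \bigcup_(X in F) X `|` S].
    have sub X : F X -> X `|` S `<=` \bigcup_(X in F) X `|` S.
      by move=> FX z [Xz|]; [left; exists X|right].
    case=> [[X FX Xx]|Sx]; case=> [[Y FY Yy]|Sy].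
    - case: (tF X Y FX FY) => h.
        by exists (Y `|` S); [exact: FP|split; [left;
          apply: h|left|exact: sub]].
      by exists (X `|` S); [exact: FP|split; [left|left; apply: h|exact: sub]].
    - by exists (X `|` S); [exact: FP|split; [left|right|exact: sub]].
    - by exists (Y `|` S); [exact: FP|split; [right|left|exact: sub]].
    - by exists S => //; split=> // z; right.
  split; last first.
    by move=> x y /dir h /h [B sB [Bx By _]] _; apply: sing_col sB Bx By.
  split=> [x Ux|x y L /dir h /h [B sB [Bx By BU]] xy lL Lx Ly].
    by have [B sB [Bx _ _]] := dir x x Ux Ux; apply: sing_pt sB Bx.
  by move=> z Lz; apply: BU; apply: (subspace_line (proj1 sB) Bx By xy lL).
exists (A `|` S); last by move=> x; right.
split=> // U sU AU; apply/seteqP; split=> // x Ux; left; apply: contrapT => nAx.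
apply: (maxA U); last by rewrite /= setUidl // => y Sy; apply: AU; right.
by split=> [y Ay|UA]; [apply: AU; left|apply: nAx; apply: UA].
Qed.

Lemma maximal_rank X : maximal_singular Pi X -> rank X n.
Proof.
move=> mX; have [m mn rX] := has_dim_rank (proj1 mX) (rankPi mX).
by have -> : n = m by lia.
Qed.

Lemma sing_rank S : sing S -> exists2 m, (m <= n)%N & rank S m.
Proof.
by move=> sS; have [X /maximal_rank rX SX] := maximal_ex sS;
  apply: (rank_sub rX) => //; case: sS.
Qed.

Definition rk (S : set T) : nat := xget 0%N [set m | rank S m].

Lemma rkE S m : rank S m -> rk S = m.
Proof. by move=> rS; apply: xget_unique => // k rk; apply: rank_uniq rk rS. Qed.

Lemma rkP S : sing S -> rank S (rk S).
Proof. by move=> /sing_rank[m _ rS]; rewrite (rkE rS). Qed.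

Lemma rk_le S : sing S -> (rk S <= n)%N.
Proof. by move=> /sing_rank[m mn rS]; rewrite (rkE rS). Qed.

Lemma sing0 : sing set0. Proof. by case: (rank_sing rank0). Qed.

Lemma rk0 : rk set0 = 0%N. Proof. exact/rkE/rank0. Qed.

Lemma rkS A B : sing A -> sing B -> A `<=` B -> (rk A <= rk B)%N.
Proof.
move=> sA sB AB; have [k km rA] := rank_sub (rkP sB) (proj1 sA) AB.
by rewrite (rkE rA).
Qed.

Lemma rk_eq A B : sing A -> sing B -> A `<=` B -> (rk B <= rk A)%N -> A = B.
Proof.
move=> sA sB AB BA; apply: (rank_full (rkP sB)) => //; first by case: sA.
have <- : rk A = rk B by apply/eqP; rewrite eqn_leq BA rkS.
exact: rkP.
Qed.

Lemma cone_singular A p : sing A -> perp A p -> ~ A p -> sing (cone p A).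
Proof. by move=> /rkP; apply: cone_sing. Qed.

Lemma rk_cone A p : sing A -> perp A p -> ~ A p -> rk (cone p A) = (rk A).+1.
Proof. by move=> sA pA nAp; apply/rkE/rankS => //; apply: rkP. Qed.

Lemma singI A B : sing A -> sing B -> sing (A `&` B).
Proof. by move=> sA sB; apply: (sub_sing _ sA) => //; apply: subspaceI;
  [case: sA|case: sB]. Qed.

Lemma singIl A B : sing A -> subspace Pi B -> sing (A `&` B).
Proof. by move=> sA sB; apply: (sub_sing _ sA) => //; apply: subspaceI => //;
  case: sA. Qed.

Lemma sing_perpP Y A p : sing Y -> A `<=` Y -> Y p -> perp A p.
Proof.
by move=> sY AY Yp; split; [apply: sing_pt sY Yp|move=> x /AY Yx;
  apply: sing_col sY Yx Yp].
Qed.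

Lemma rk_hyperplane S H : sing S -> subspace Pi H -> H `<=` S ->
  (forall L, lines Pi L -> L `<=` S -> exists2 h, L h & H h) ->
  (rk S <= (rk H).+1)%N.
Proof.
move=> sS uH HS mH.
have [SH|/existsNP[x /not_implyP[Sx nHx]]] := pselect (S `<=` H).
  by apply/leqW/rkS => //; apply: sub_sing sS HS.
have [k -> /rkE ->] := rank_hyperplane (rkP sS) uH HS mH Sx nHx.
exact: leqnn.
Qed.

Lemma subset_ex A B : ~ (A `<=` B) -> exists2 x : T, A x & ~ B x.
Proof. by move=> /existsNP[x /not_implyP[]]; exists x. Qed.

(** One half of the modular law: intersecting with a hyperplane lowers the rank
    by at most one, and B is reached from Y through a chain of hyperplanes. *)
Lemma rk_cap Y A B : sing Y -> sing A -> sing B -> A `<=` Y -> B `<=` Y ->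
  (rk A + rk B <= rk (A `&` B) + rk Y)%N.
Proof.
move=> sY sA sB AY; move: B sB.
suff H k : forall B, sing B -> B `<=` Y -> (rk Y - rk B = k)%N ->
    (rk A + rk B <= rk (A `&` B) + rk Y)%N.
  by move=> B sB BY; apply: (H _ B sB BY erefl).
elim: k => [|k IH] B sB BY e.
  have -> : B = Y by apply: rk_eq => //; lia.
  by rewrite setIidl.
have [|b Yb nBb] := @subset_ex Y B.
  by move=> YB; have := rkS sY sB YB; lia.
have bB : perp B b by apply: sing_perpP sY BY Yb.
have sC := cone_singular sB bB nBb.
have rC := rk_cone sB bB nBb.
have CY : cone b B `<=` Y by apply: cone_min => //; case: sY.
have := IH _ sC CY ltac:(lia); rewrite rC.
suff : (rk (A `&` cone b B) <= (rk (A `&` B)).+1)%N by lia.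
apply: rk_hyperplane; first exact: singI.
- by have [] := singI sA sB.
- by move=> x [Ax Bx]; split=> //; apply: cone_sub.
- move=> L lL LS; have [|h Lh Bh] := cone_line_meet (rkP sB) bB nBb lL.
    by move=> x /LS[].
  by exists h => //; split=> //; have [] := LS _ Lh.
Qed.

(** Each further generator of B over A cuts X by at most a hyperplane. *)
Lemma rk_perp X A B : sing X -> sing A -> sing B -> A `<=` B -> X `<=` perp A ->
  (rk X + rk A <= rk (X `&` perp B) + rk B)%N.
Proof.
move=> sX sA sB AB.
suff H k : forall X A, sing X -> sing A -> A `<=` B -> X `<=` perp A ->
    (rk B - rk A = k)%N -> (rk X + rk A <= rk (X `&` perp B) + rk B)%N.
  by move=> XA; apply: (H _ X A sX sA AB XA erefl).
elim: k {A sA X sX AB} => [|k IH] X A sX sA AB XA e.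
  have -> : A = B by apply: rk_eq => //; lia.
  have eA : A = B by apply: rk_eq => //; lia.
  by rewrite setIidl // -eA.
have [|b Bb nAb] := @subset_ex B A.
  by move=> BA; have := rkS sB sA BA; lia.
have bA : perp A b by apply: sing_perpP sB AB Bb.
have sC := cone_singular sA bA nAb.
have CB : cone b A `<=` B by apply: cone_min => //; case: sB.
have sX' : sing (X `&` perp [set b]) by apply: singIl => //;
  apply: perp_subspace.
have X'C : X `&` perp [set b] `<=` perp (cone b A).
  move=> x [Xx [ptx xb]]; split=> // y [->|[a [L [Aa lL Lb La Ly]]]].
    by apply: xb.
  have ba : b <> a by move=> E; apply: nAb; rewrite E.
  apply: col_sym; apply: (col_line ba lL Lb La Ly); apply: col_sym;
    first exact: xb.
  by case: (XA _ Xx) => _; apply.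
have := IH _ _ sX' sC CB X'C ltac:(rewrite (rk_cone sA bA nAb); lia).
rewrite (rk_cone sA bA nAb).
have : (rk (X `&` perp [set b] `&` perp B) <= rk (X `&` perp B))%N.
  apply: rkS; first by apply: singIl => //; apply: perp_subspace.
    by apply: singIl => //; apply: perp_subspace.
  by move=> x [[Xx _] xB].
have : (rk X <= (rk (X `&` perp [set b])).+1)%N.
  apply: rk_hyperplane => //; first by case: sX'.
  move=> L lL LX; have [h Lh bh] := meet_line (proj1 bA) lL.
  exists h => //; split; first exact: LX.
  by split; [apply: line_pt lL Lh|move=> y ->].
lia.
Qed.

(** The span of two collinear singular subspaces and the full modular law. *)
Lemma join_ex A B : sing A -> sing B -> A `<=` perp B -> exists J,
  [/\ sing J, A `<=` J, B `<=` J,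
      forall S, subspace Pi S -> A `<=` S -> B `<=` S -> J `<=` S
    & (rk J + rk (A `&` B) = rk A + rk B)%N].
Proof.
move=> sA sB AB.
suff H k : forall A, sing A -> A `<=` perp B -> (rk B - rk (A `&` B) = k)%N ->
    exists J, [/\ sing J, A `<=` J, B `<=` J,
      forall S, subspace Pi S -> A `<=` S -> B `<=` S -> J `<=` S
    & (rk J + rk (A `&` B) <= rk A + rk B)%N].
  have [J [sJ AJ BJ minJ rJ]] := H _ A sA AB erefl.
  by exists J; split=> //; have := rk_cap sJ sA sB AJ BJ; lia.
elim: k {A sA AB} => [|k IH] A sA AB e.
  have BA : B `<=` A.
    have <- : A `&` B = B by apply: rk_eq => //; [exact: singI|lia].
    by move=> ? [].
  by exists A; split=> //; rewrite setIidr // addnC.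
have sAB := singI sA sB.
have [|b Bb nAb] := @subset_ex B A.
  by move=> BA; move: e; rewrite setIidr //; lia.
have bA : perp A b.
  split; first exact: sing_pt sB Bb.
  by move=> x /AB[_ /(_ _ Bb)/col_sym].
have sC := cone_singular sA bA nAb.
have CB : cone b A `<=` perp B.
  by apply: cone_min => //; [exact: perp_subspace|apply: sing_perp].
have rI : ((rk (A `&` B)).+1 <= rk (cone b A `&` B))%N.
  have bAB : perp (A `&` B) b by apply: perpS bA => ? [].
  have nABb : ~ (A `&` B) b by case.
  rewrite -(rk_cone sAB bAB nABb); apply: rkS;
    [exact: cone_singular|exact: singI|].
  apply: cone_min => //; first by case: (singI sC sB).
    by move=> x [Ax Bx]; split=> //; apply: cone_sub.
  by split=> //; apply: cone_p.
have rC := rk_cone sA bA nAb.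
have := rkS sAB sB (@subIsetr _ A B) => le1.
have sCB := singI sC sB.
have := rkS sCB sB (@subIsetr _ _ B) => le2.
have [J [sJ CJ BJ minJ rJ]] : exists J, [/\ sing J, cone b A `<=` J, B `<=` J,
      forall S, subspace Pi S -> cone b A `<=` S -> B `<=` S -> J `<=` S
    & (rk J + rk (cone b A `&` B) <= rk (cone b A) + rk B)%N].
  apply: IH => //.
  suff : (rk (cone b A `&` B) <= (rk (A `&` B)).+1)%N by lia.
  apply: rk_hyperplane => //; first by case: sAB.
    by move=> x [Ax Bx]; split=> //; apply: cone_sub.
  move=> L lL LS; have [|h Lh Ah] := cone_line_meet (rkP sA) bA nAb lL.
    by move=> x /LS[].
  by exists h => //; split=> //; have [] := LS _ Lh.
exists J; split=> //; last by lia.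
  by apply: subset_trans CJ; apply: cone_sub.
move=> S uS AS BS; apply: minJ => //; apply: cone_min => //; exact: BS.
Qed.

Lemma hyperplane_avoiding W A r : sing W -> sing A -> A `<=` W -> W r ->
  ~ A r ->
  exists H, [/\ sing H, A `<=` H, H `<=` W, ~ H r & (rk H).+1 = rk W].
Proof.
move=> sW sA AW Wr nAr.
suff H k : forall A, sing A -> A `<=` W -> ~ A r -> (rk W - rk A = k)%N ->
    exists H, [/\ sing H, A `<=` H, H `<=` W, ~ H r & (rk H).+1 = rk W].
  exact: (H _ A sA AW nAr erefl).
elim: k {A sA AW nAr} => [|k IH] A sA AW nAr e.
  by have eA : A = W; [apply: rk_eq => //; lia|case: nAr; rewrite eA].
have rA : perp A r by apply: sing_perpP sW AW Wr.
have sC := cone_singular sA rA nAr.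
have rC := rk_cone sA rA nAr.
have CW : cone r A `<=` W by apply: cone_min => //; case: sW.
have [WC|/subset_ex[s Ws nCs]] := pselect (W `<=` cone r A).
  by exists A; split=> //; rewrite -rC; congr rk; apply/seteqP; split.
have nAs : ~ A s by move=> As; apply: nCs; apply: cone_sub.
have aS : perp A s by apply: sing_perpP sW AW Ws.
have [||||H [sH CH HW nHr rH]] := IH (cone s A).
- exact: cone_singular.
- by apply: cone_min => //; case: sW.
- move=> sr; apply: nCs.
  by rewrite (cone_exchange (rkP sA) aS nAs sr nAr); apply: cone_p.
- by rewrite rk_cone //; lia.
by exists H; split=> //; apply: subset_trans CH; apply: cone_sub.
Qed.

Definition is_max X := sing X /\ rk X = n.

Lemma is_maxP X : maximal_singular Pi X <-> is_max X.
Proof.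
split=> [mX|[sX rX]]; first by split; [case: mX|apply/rkE/maximal_rank].
split=> // U sU XU; symmetry; apply: rk_eq => //.
by rewrite rX; apply: rk_le.
Qed.

Lemma max_ex S : sing S -> exists2 X, is_max X & S `<=` X.
Proof. by move=> /maximal_ex[X /is_maxP mX SX]; exists X. Qed.

Lemma max_perp X p : is_max X -> perp X p -> X p.
Proof.
move=> [sX rX] pX; apply: contrapT => nXp.
have := rk_le (cone_singular sX pX nXp); rewrite rk_cone // rX; lia.
Qed.

Lemma GrE S (k : int) : Gr Pi k S <-> sing S /\ ((rk S)%:Z = k + 1)%R.
Proof.
split=> [[sS dS]|[sS e]]; last by split=> //; apply: (rank_has_dim (rkP sS)).
by have [m e /rkE ->] := has_dim_rank sS dS.
Qed.

(** The distance of the dual polar graph, see dual_distance. *)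
Definition dist X Y := (n - rk (X `&` Y))%N.

Lemma maxI X Y : is_max X -> is_max Y -> sing (X `&` Y).
Proof. by move=> [sX _] [sY _]; apply: singI. Qed.

Lemma distP X Y : is_max X -> is_max Y -> (rk (X `&` Y) + dist X Y = n)%N.
Proof. by move=> mX mY; rewrite /dist subnKC // rk_le //; apply: maxI. Qed.

Lemma dist_sym X Y : dist X Y = dist Y X.
Proof. by rewrite /dist setIC. Qed.

Lemma dist_xx X : is_max X -> dist X X = 0%N.
Proof. by move=> [_ rX]; rewrite /dist setIid rX subnn. Qed.

Lemma max_sub X Y : is_max X -> is_max Y -> X `<=` Y -> X = Y.
Proof. by move=> [sX rX] [sY rY] XY; apply: rk_eq => //; rewrite rX rY. Qed.

Lemma dist_eq0 X Y : is_max X -> is_max Y -> dist X Y = 0%N -> X = Y.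
Proof.
move=> mX mY d0; have := distP mX mY; rewrite d0 addn0 => r.
apply: max_sub => //; suff <- : X `&` Y = X by [].
apply: rk_eq => //; [exact: maxI|by case: mX|by rewrite r; case: mX => _ ->].
Qed.

End PolarSpace.

(** * The dual polar graph of a polar space of type D *)

Section Thin.
Context {T : Type} {n : nat} (Pi : thin_polar_geometry T n).

Local Notation sing := (singular Pi).
Local Notation col := (collinear Pi).
Local Notation perp := (perp Pi).
Local Notation cone := (cone Pi).
Local Notation rk := (rk Pi).
Local Notation is_max := (is_max Pi).
Local Notation dist := (dist Pi).
Local Notation rk_eq := (@rk_eq T n Pi _ _).
Local Notation max_sub := (@max_sub T n Pi _ _).
Local Notation dist_sym := (dist_sym Pi).
Local Notation sing0 := (sing0 Pi).
Local Notation col_sym := (@col_sym T n Pi _ _).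
Local Notation max_perp := (@max_perp T n Pi _ _).
Local Notation perp_subspace := (perp_subspace Pi).

Lemma thin_pair H : sing H -> (rk H).+1 = n -> exists X Y,
  [/\ X <> Y, is_max X, is_max Y, H `<=` X & H `<=` Y /\
      forall Z, is_max Z -> H `<=` Z -> Z = X \/ Z = Y].
Proof.
move=> sH rH.
have /geometry_thin/eq_cardSP[X [/is_maxP mX HX] /eq_cardSP[Y [[/is_maxP mY HY]
  nYX]]] : Gr Pi (n%:Z - 2)%R H.
  by apply/GrE; split=> //; lia.
rewrite II0 card_eq0 => /eqP e.
exists X, Y; split=> //; first exact/nesym.
split=> // Z mZ HZ; have [->|ZX] := pselect (Z = X); first by left.
have [->|ZY] := pselect (Z = Y); first by right.
suff : set0 Z by [].
by rewrite -e; split=> //; split=> //; split=> //; apply/is_maxP.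
Qed.

Lemma thin_other H X : sing H -> (rk H).+1 = n ->
  exists2 Y, is_max Y & H `<=` Y /\ Y <> X.
Proof.
move=> sH rH; have [Y [Z [YZ mY mZ HY [HZ _]]]] := thin_pair sH rH.
have [e|] := pselect (Y = X); last by exists Y.
by exists Z => //; split=> // e'; apply: YZ; rewrite e e'.
Qed.

Lemma thin_uniq H X Y Z : sing H -> (rk H).+1 = n -> is_max X -> is_max Y ->
  is_max Z ->
  H `<=` X -> H `<=` Y -> H `<=` Z -> Y <> X -> Z <> X -> Y = Z.
Proof.
move=> sH rH mX mY mZ HX HY HZ YX ZX; have [A [B [AB mA mB HA [HB h]]]] :=
  thin_pair sH rH.
have hX := h X mX HX; have hY := h Y mY HY; have hZ := h Z mZ HZ.
by case: hX => eX; case: hY => eY; case: hZ => eZ; move: YX ZX;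
  rewrite ?eX ?eY ?eZ.
Qed.

Lemma dist1_rk X Y : is_max X -> is_max Y -> dist X Y = 1%N ->
  (rk (X `&` Y)).+1 = n.
Proof. by move=> mX mY d1; have := distP mX mY; lia. Qed.

Lemma dist1_neq X Y : is_max X -> dist X Y = 1%N -> X <> Y.
Proof. by move=> mX d1 e; move: d1; rewrite -e dist_xx. Qed.

Lemma hyperplane_dist1 X Y H : is_max X -> is_max Y -> sing H -> H `<=` X ->
  H `<=` Y -> (rk H).+1 = n ->
  X <> Y -> X `&` Y = H /\ dist X Y = 1%N.
Proof.
move=> mX mY sH HX HY rH XY; have sXY := maxI mX mY.
have r := distP mX mY.
have d0 : dist X Y <> 0%N by move/(dist_eq0 mX mY).
have HXY : H `<=` X `&` Y by move=> x Hx; split; [apply: HX|apply: HY].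
have := rkS sH sXY HXY => le1.
by split; [symmetry; apply: rk_eq => //|]; lia.
Qed.

(** Adjacent X and Y are never equally far from W. The perp of X & Y contains a
    point w of W outside X, by counting ranks; the cone of w over X & Y is maximal
    and different from X, so it is Y, because only two maximal singular subspaces
    pass through X & Y. *)
Lemma dist_closer W X Y : is_max W -> is_max X -> is_max Y -> dist X Y = 1%N ->
  W `&` X `<=` Y -> dist W X = (dist W Y).+1.
Proof.
move=> mW mX mY d1 WXY.
have rH := dist1_rk mX mY d1; have nXY := dist1_neq mX d1.
have sH := maxI mX mY; have sWX := maxI mW mX; have sWY := maxI mW mY.
have WXH : W `&` X `<=` X `&` Y by move=> x Wx; split; [case: Wx|apply: WXY].
have sW := proj1 mW; have sX := proj1 mX.
have [w [Ww wH] nWXw] : exists2 w, (W `&` perp (X `&` Y)) w & ~ (W `&` X) w.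
  apply: subset_ex => sub.
  have := rk_perp sW sWX sH WXH.
  have := rkS (singIl sW (perp_subspace (X `&` Y))) sWX sub.
  have -> : rk W = n by case: mW.
  suff h : W `<=` perp (W `&` X) by move=> h1 /(_ h); lia.
  by move=> x Wx; apply: sing_perpP sW _ Wx => y [].
have nHw : ~ (X `&` Y) w by move=> [Xw _]; apply: nWXw.
have mZ : is_max (cone w (X `&` Y)).
  by split; [exact: cone_singular|rewrite rk_cone].
have Yw : Y w.
  have -> : Y = cone w (X `&` Y); last exact: cone_p.
  apply: (thin_uniq sH rH mX mY mZ) => //; try by move=> x [].
  - exact: cone_sub.
  - by move/nesym: nXY.
  - by move=> e; apply: nWXw; split=> //; rewrite -e; apply: cone_p.
have wWX : perp (W `&` X) w by apply: sing_perpP sW _ Ww => y [].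
have : ((rk (W `&` X)).+1 <= rk (W `&` Y))%N.
  rewrite -(rk_cone sWX wWX nWXw); apply: rkS => //; first exact: cone_singular.
  apply: cone_min => //; first by case: sWY.
  by move=> x Wx; split; [case: Wx|apply: WXY].
have := rk_cap (proj1 mY) sWY sH (@subIsetr _ _ _) (@subIsetr _ _ _).
have -> : rk Y = n by case: mY.
have : (rk (W `&` Y `&` (X `&` Y)) <= rk (W `&` X))%N.
  by apply: rkS => //; [exact: singI|move=> x [[? ?] [? ?]]].
have := distP mW mX; have := distP mW mY; lia.
Qed.

(** By symmetry with dist_closer, unless W has a point a of X outside Y and a point
    b of Y outside X; these are collinear, so b would be collinear to the cone X
    of a over X & Y, hence in X. *)
Lemma dist_farther W X Y : is_max W -> is_max X -> is_max Y -> dist X Y = 1%N ->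
  ~ (W `&` X `<=` Y) -> dist W Y = (dist W X).+1.
Proof.
move=> mW mX mY d1 /subset_ex[a [Wa Xa] nYa].
apply: dist_closer => //; first by rewrite dist_sym.
move=> b [Wb Yb]; apply: contrapT => nXb; apply: nXb; apply: max_perp => //.
have sH := maxI mX mY; have rH := dist1_rk mX mY d1.
have aH : perp (X `&` Y) a by apply: sing_perpP (proj1 mX) _ Xa => x [].
have nHa : ~ (X `&` Y) a by case.
have -> : X = cone a (X `&` Y).
  symmetry; apply: max_sub => //.
    by split; [exact: cone_singular|rewrite rk_cone].
  by apply: cone_min => //; case: mX => -[].
have [ptb bY] : perp Y b by apply: sing_perp (proj1 mY) _ Yb.
suff h : cone a (X `&` Y) `<=` perp [set b].
  by split=> // x /h[_ /(_ b erefl)/col_sym].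
apply: cone_min => //; first exact: perp_subspace.
  move=> x [_ Yx]; split; first exact: sing_pt (proj1 mY) Yx.
  by move=> y ->; apply: sing_col (proj1 mY) Yb Yx.
split; first exact: sing_pt (proj1 mX) Xa.
by move=> y ->; apply: sing_col (proj1 mW) Wb Wa.
Qed.

Lemma dist_step W X Y : is_max W -> is_max X -> is_max Y -> dist X Y = 1%N ->
  dist W X = (dist W Y).+1 \/ dist W Y = (dist W X).+1.
Proof.
move=> mW mX mY d1; have [h|h] := pselect (W `&` X `<=` Y).
  by left; apply: dist_closer.
by right; apply: dist_farther.
Qed.

(** The first step of a geodesic from Y to X: the cone of x over the hyperplane of
    Y collinear to x. *)
Lemma toward X Y x : is_max X -> is_max Y -> X x -> ~ Y x -> exists Z,
  [/\ is_max Z, Z x, Y `&` perp [set x] `<=` Z,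
    dist Y Z = 1%N & dist X Y = (dist X Z).+1].
Proof.
move=> mX mY Xx nYx; have sY := proj1 mY.
have ptx := sing_pt (proj1 mX) Xx.
have sH : sing (Y `&` perp [set x]) by apply: singIl => //;
  apply: perp_subspace.
have nHx : ~ (Y `&` perp [set x]) x by case.
have xH : perp (Y `&` perp [set x]) x.
  by split=> // y [_ [_ /(_ x erefl)/col_sym]].
have rH : (rk Y <= (rk (Y `&` perp [set x])).+1)%N.
  apply: rk_hyperplane => //; first by case: sH.
  move=> L lL LY; have [h Lh xh] := meet_line ptx lL.
  exists h => //; split; first exact: LY.
  by split; [apply: line_pt lL Lh|move=> y ->].
have sC := cone_singular sH xH nHx.
have rC := rk_cone sH xH nHx.
have := rk_le sC; rewrite rC => rle.
have rY := proj2 mY.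
have rH' : (rk (Y `&` perp [set x])).+1 = n by lia.
have mC : is_max (cone x (Y `&` perp [set x])) by split=> //; rewrite rC.
have [||e d1] := hyperplane_dist1 mY mC sH _ (cone_sub xH) rH'.
- by move=> y [].
- by move=> e; apply: nYx; rewrite e; apply: cone_p.
exists (cone x (Y `&` perp [set x])); split=> //.
- exact: cone_p.
- exact: cone_sub.
apply: dist_closer => // y [Xy Yy]; apply: cone_sub => //; split=> //.
by split; [apply: sing_pt sY Yy|move=> z ->; apply: sing_col (proj1 mX) Xx Xy].
Qed.

Lemma dist_gt0 X Y : is_max X -> is_max Y -> (0 < dist X Y)%N ->
  exists2 x, X x & ~ Y x.
Proof.
move=> mX mY d0; apply: subset_ex => /(max_sub mX mY) e.
by move: d0; rewrite e dist_xx.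
Qed.

Lemma dist_triangle X Y Z : is_max X -> is_max Y -> is_max Z ->
  (dist X Z <= dist X Y + dist Y Z)%N.
Proof.
move=> mX mY mZ; have := distP mX mY; have := distP mY mZ; have := distP mX mZ.
have sXY := maxI mX mY; have sYZ := maxI mY mZ.
have := rk_cap (proj1 mY) sXY sYZ (@subIsetr _ _ _) (@subIsetl _ _ _).
have : (rk (X `&` Y `&` (Y `&` Z)) <= rk (X `&` Z))%N.
  by apply: rkS; [exact: singI|exact: maxI|move=> x [[? ?] [? ?]]].
have -> : rk Y = n by case: mY.
lia.
Qed.

(** Inside Y the subspaces X & Y and Y & Z meet in rank at least that of X & Z, so
    all of X & Z lies in Y: intersections are geodesically convex. *)
Lemma dist_convex X Y Z : is_max X -> is_max Y -> is_max Z ->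
  dist X Z = (dist X Y + dist Y Z)%N ->
  X `&` Z `<=` Y.
Proof.
move=> mX mY mZ e; have := distP mX mY; have := distP mY mZ;
  have := distP mX mZ.
have sXY := maxI mX mY; have sYZ := maxI mY mZ.
have := rk_cap (proj1 mY) sXY sYZ (@subIsetr _ _ _) (@subIsetl _ _ _).
have -> : rk Y = n by case: mY.
move=> h1 h2 h3 h4.
have <- : X `&` Y `&` (Y `&` Z) = X `&` Z.
  by apply: rk_eq; [exact: singI|exact: maxI|move=> x [[? ?] [? ?]]|lia].
by move=> x [[]].
Qed.

Lemma dist_odd X Y Z : is_max X -> is_max Y -> is_max Z ->
  odd (dist X Z) = odd (dist X Y) (+) odd (dist Y Z).
Proof.
move=> mX mY; move e : (dist Y Z) => k; elim: k Z e => [|k IH] Z e mZ.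
  by rewrite (dist_eq0 mY mZ e) addbF.
have [|x Yx nZx] := dist_gt0 mY mZ; first by rewrite e.
have [Z' [mZ' _ _ d1 eZ']] := toward mY mZ Yx nZx.
have -> : odd (dist X Z) = ~~ odd (dist X Z').
  by have [->|->] := dist_step mX mZ mZ' d1; rewrite /= ?negbK.
by rewrite (IH Z' _ mZ') ?addbN //; lia.
Qed.

(** The other maximal singular subspace on a hyperplane of X through A without r. *)
Lemma away X A r : is_max X -> sing A -> A `<=` X -> X r -> ~ A r ->
  exists Y, [/\ is_max Y, A `<=` Y, ~ Y r & dist X Y = 1%N].
Proof.
move=> mX sA AX Xr nAr.
have [H [sH AH HX nHr rH]] := hyperplane_avoiding (proj1 mX) sA AX Xr nAr.
have {}rH : (rk H).+1 = n by rewrite rH; case: mX.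
have [Y mY [HY YX]] := thin_other X sH rH.
have [e d1] := hyperplane_dist1 mX mY sH HX HY rH (nesym YX).
exists Y; split=> //; first exact: subset_trans HY.
by move=> Yr; apply: nHr; rewrite -e.
Qed.

(** As long as W meets U outside A, a step away through A shrinks the
    intersection. For A inside U this yields W with W & U = A. *)
Lemma opposite_through A U : sing A -> is_max U ->
  exists W, [/\ is_max W, A `<=` W & W `&` U `<=` A].
Proof.
move=> sA mU; have [W mW AW] := max_ex sA.
move e : (rk (W `&` U)) => k; elim: k W mW AW e => [|k IH] W mW AW e.
  exists W; split=> //; have -> : W `&` U = set0; last by [].
  by symmetry; apply: rk_eq; rewrite ?e //; [exact: sing0|exact: maxI].
have [h|/subset_ex[r [Wr Ur] nAr]] := pselect (W `&` U `<=` A);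
  first by exists W.
have [Y [mY AY nYr d1]] := away mW sA AW Wr nAr.
apply: (IH Y) => //.
have : dist U Y = (dist U W).+1 by apply: dist_farther => // /(_ r (conj Ur
  Wr)).
have := distP mU mY; have := distP mU mW; rewrite (setIC U) (setIC U) e; lia.
Qed.

(** The gate of W on N is the span P of N and the part of W collinear to N. Any Z
    through N meets W inside P, so that W & P and P & Z span P and meet in
    W & Z; the modular law turns this into additivity of distances. *)
Lemma gate W N : is_max W -> sing N -> exists P, [/\ is_max P, N `<=` P &
  forall Z, is_max Z -> N `<=` Z -> dist W Z = (dist W P + dist P Z)%N].
Proof.
move=> mW sN; have sW := proj1 mW.
have sK : sing (W `&` perp N) by apply: singIl => //; apply: perp_subspace.
have NK : N `<=` perp (W `&` perp N).
  move=> x Nx; split; first exact: sing_pt sN Nx.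
  by move=> y [_ [_ /(_ _ Nx)/col_sym]].
have [P [sP NP KP minP rP]] := join_ex sN sK NK.
have mP : is_max P.
  split=> //; apply/eqP; rewrite eqn_leq rk_le //=.
  have sI := singI sW sN.
  have := rk_perp sW sI sN (@subIsetr _ _ _).
  have -> : rk W = n by case: mW.
  have h : W `<=` perp (W `&` N) by move=> x Wx;
    apply: sing_perpP sW _ Wx => y [].
  move=> /(_ h).
  have : (rk (N `&` (W `&` perp N)) <= rk (W `&` N))%N.
    by apply: rkS => //; [exact: singI|move=> x [? []]].
  lia.
exists P; split=> // Z mZ NZ.
have sWP := maxI mW mP; have sPZ := maxI mP mZ.
have WPZ : W `&` P `<=` perp (P `&` Z).
  by move=> x [_ Px]; apply: sing_perpP sP _ Px => y [].
have [J [sJ WPJ PZJ minJ rJ]] := join_ex sWP sPZ WPZ.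
have PJ : P `<=` J.
  apply: minP; first by case: sJ.
    by move=> x Nx; apply: PZJ; split; [apply: NP|apply: NZ].
  by move=> x Kx; apply: WPJ; split; [case: Kx|apply: KP].
have := rkS sP sJ PJ; have -> : rk P = n by case: mP.
have : (rk (W `&` Z) <= rk (W `&` P `&` (P `&` Z)))%N.
  apply: rkS; [exact: maxI|exact: singI|move=> x [Wx Zx]].
  suff Px : P x by [].
  by apply: KP; split=> //; apply: sing_perpP (proj1 mZ) NZ Zx.
have := dist_triangle mW mP mZ; have := distP mW mP; have := distP mP mZ;
  have := distP mW mZ.
have := rk_le sJ; lia.
Qed.

Lemma GrE_max X : Gr Pi (n%:Z - 1)%R X <-> is_max X.
Proof.
split=> [/GrE[sX e]|[sX e]]; first by split=> //; lia.
by apply/GrE; split=> //; lia.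
Qed.

Lemma has_distance_uniq A (Gamma : graph A) x y j k :
  has_distance Gamma x y j -> has_distance Gamma x y k -> j = k.
Proof.
by move=> [wj mj] [wk mk]; apply/eqP; rewrite eqn_leq mj // mk.
Qed.

Lemma dual_distance X Y : is_max X -> is_max Y ->
  has_distance (dual_polar_graph Pi n) X Y (dist X Y).
Proof.
move=> mX mY; split=> [|j w].
  move e : (dist X Y) => k; elim: k Y mY e => [|k IH] Y mY e.
    rewrite -(dist_eq0 mX mY e); constructor; exact/GrE_max.
  have [|x Xx nYx] := dist_gt0 mX mY; first by rewrite e.
  have [Z [mZ _ _ d1 eZ]] := toward mX mY Xx nYx.
  apply: (@walk_step _ _ _ _ Z); [by apply: IH => //; lia|exact/GrE_max|].
  apply/GrE; rewrite setIC; split; first exact: maxI.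
  by have := distP mY mZ; lia.
suff : is_max Y /\ (dist X Y <= j)%N by case.
elim: w mX {mY} => {X Y j} [X _ mX|j X Y Z _ IH /GrE_max mZ /GrE[sYZ rYZ] mX].
  by rewrite dist_xx.
have [mY le1] := IH mX.
by split=> //; have := dist_triangle mX mY mZ; have := distP mY mZ; lia.
Qed.

(** The key fact on type D. If Z and Z' in C meet in A = X & Y, then every
    neighbour W of Z through A is one step closer to Z', hence in C, because
    adjacent vertices are never equally far. Likewise C contains a neighbour of
    Z' that meets W in A, so the step can be repeated from W. *)
Lemma convex_through (C : set (set T)) X Y :
  (forall Z W Z', C Z -> C Z' -> is_max W ->
    dist Z Z' = (dist Z W + dist W Z')%N -> C W) ->
  is_max X -> is_max Y -> C X -> C Y ->
  forall W, is_max W -> X `&` Y `<=` W -> C W.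
Proof.
move=> cC mX mY CX CY.
have sA := maxI mX mY.
suff H W : is_max W -> X `&` Y `<=` W ->
    C W /\ exists W', [/\ is_max W', C W' & W `&` W' = X `&` Y].
  by move=> W mW AW; have [] := H W mW AW.
move e : (dist X W) => k; elim: k W e => [|k IH] W e mW AW.
  by rewrite -(dist_eq0 mX mW e); split=> //; exists Y.
have [|x Xx nWx] := dist_gt0 mX mW; first by rewrite e.
have [Z [mZ Zx subZ d1 eZ]] := toward mX mW Xx nWx.
have AZ : X `&` Y `<=` Z.
  move=> y Ay; apply: subZ; split; first exact: AW.
  split; first by case: Ay => /(sing_pt (proj1 mX)).
  by move=> z ->; apply: sing_col (proj1 mX) Xx (proj1 Ay).
have [CZ [Z' [mZ' CZ' eA]]] := IH Z ltac:(lia) mZ AZ.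
have dZW : dist Z W = 1%N by rewrite dist_sym.
have h1 : dist Z' Z = (dist Z' W).+1.
  by apply: dist_closer => //; rewrite setIC eA.
have CW : C W.
  by apply: (cC Z W Z') => //; rewrite dZW dist_sym h1 (dist_sym Z').
split=> //.
have AZ' : X `&` Y `<=` Z' by rewrite -eA => ? [].
have [r [Wr Z'r] nAr] : exists2 r, (W `&` Z') r & ~ (X `&` Y) r.
  apply: subset_ex => sub; have := rkS (maxI mW mZ') sA sub.
  by rewrite -eA; have := distP mZ mZ'; have := distP mW mZ';
    rewrite dist_sym (dist_sym Z); lia.
have [Z'' [mZ'' AZ'' nr d1']] := away mZ' sA AZ' Z'r nAr.
have h2 : dist Z Z' = (dist Z Z'').+1 by apply: dist_closer => //; rewrite eA.
have h3 : dist W Z'' = (dist W Z').+1 by apply: dist_farther => // /(_ r (conj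
  Wr Z'r)).
exists Z''; split=> //.
  by apply: (cC Z Z'' Z') => //; rewrite h2 (dist_sym Z'') d1' addn1.
symmetry; apply: rk_eq => //; first exact: maxI.
  by move=> y Ay; split; [apply: AW|apply: AZ''].
rewrite !(dist_sym Z') in h1.
by rewrite -eA; have := distP mZ mZ'; have := distP mW mZ''; lia.
Qed.

Lemma dist_ge_cap X Y N : is_max X -> is_max Y -> sing N -> N `<=` X ->
  N `<=` Y ->
  (rk N + dist X Y <= n)%N.
Proof.
move=> mX mY sN NX NY; have := distP mX mY.
have := rkS sN (maxI mX mY) (fun x Nx => conj (NX x Nx) (NY x Nx)); lia.
Qed.

(** Rank n - 4 is excluded: X & Y and X & Z would span X, and Y & Z, collinear to
    both, would lie in X. *)
Lemma triple_rank X Y Z : is_max X -> is_max Y -> is_max Z ->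
  dist X Y = 2%N -> dist X Z = 2%N -> dist Y Z = 2%N -> ~ (X `&` Y `<=` Z) ->
  (rk (X `&` Y `&` Z) + 3 = n)%N.
Proof.
move=> mX mY mZ dXY dXZ dYZ nsub.
have sXY := maxI mX mY; have sXZ := maxI mX mZ; have sYZ := maxI mY mZ.
have sI := singI sXY (proj1 mZ).
have rXY := distP mX mY; have rXZ := distP mX mZ; have rYZ := distP mY mZ.
have eI : X `&` Y `&` (X `&` Z) = X `&` Y `&` Z.
  by apply/seteqP; split=> x [[? ?]]; [case|]; split.
have lt : (rk (X `&` Y `&` Z) < rk (X `&` Y))%N.
  rewrite ltnNge; apply/negP => le; apply: nsub.
  by rewrite -(rk_eq sI sXY _ le) => x [].
have XYp : X `&` Y `<=` perp (X `&` Z).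
  by move=> x [Xx _]; apply: sing_perpP (proj1 mX) _ Xx => y [].
have [J [sJ XYJ XZJ minJ rJ]] := join_ex sXY sXZ XYp.
rewrite eI in rJ.
have JX : J `<=` X by apply: minJ => [|x []|x []] //; case: mX => -[].
have := rk_le sJ.
suff : rk J <> n by lia.
move=> rJn; have XJ : J = X by apply: max_sub.
have YZX : Y `&` Z `<=` X.
  move=> y [Yy Zy]; apply: max_perp => //.
  have pty := sing_pt (proj1 mY) Yy.
  suff h : X `<=` perp [set y] by split=> // x /h[_ /(_ y erefl)/col_sym].
  rewrite -XJ; apply: minJ; first exact: perp_subspace.
    move=> x [_ Yx]; split; first exact: sing_pt (proj1 mY) Yx.
    by move=> _ ->; apply: sing_col (proj1 mY) Yy Yx.
  move=> x [_ Zx]; split; first exact: sing_pt (proj1 mZ) Zx.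
  by move=> _ ->; apply: sing_col (proj1 mZ) Zy Zx.
have : (rk (Y `&` Z) <= rk (X `&` Y `&` Z))%N.
  by apply: rkS => // x Yx; split; [split; [exact: YZX|case: Yx]|case: Yx].
lia.
Qed.

Lemma triple_hyperplane X Y Z : is_max X -> is_max Y -> is_max Z ->
  dist X Y = 2%N -> dist X Z = 2%N -> dist Y Z = 2%N -> ~ (X `&` Y `<=` Z) ->
  exists J, [/\ sing J, (rk J).+1 = n, X `&` Y `<=` J, X `&` Z `<=` J &
    forall S, subspace Pi S -> X `&` Y `<=` S -> X `&` Z `<=` S -> J `<=` S].
Proof.
move=> mX mY mZ dXY dXZ dYZ nsub.
have sXY := maxI mX mY; have sXZ := maxI mX mZ.
have XYp : X `&` Y `<=` perp (X `&` Z).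
  by move=> x [Xx _]; apply: sing_perpP (proj1 mX) _ Xx => y [].
have [J [sJ XYJ XZJ minJ rJ]] := join_ex sXY sXZ XYp.
exists J; split=> //.
have eI : X `&` Y `&` (X `&` Z) = X `&` Y `&` Z.
  by apply/seteqP; split=> x [[? ?]]; [case|]; split.
have := triple_rank mX mY mZ dXY dXZ dYZ nsub.
by have := distP mX mY; have := distP mX mZ; rewrite eI in rJ; lia.
Qed.

(** The other maximal singular subspace through the hyperplane of X spanned by
    X & Y and X & Z; it contains rank n - 2 of Y and of Z, and parity does the
    rest. *)
Lemma triple_neighbour X Y Z : is_max X -> is_max Y -> is_max Z ->
  dist X Y = 2%N -> dist X Z = 2%N -> dist Y Z = 2%N -> ~ (X `&` Y `<=` Z) ->
  exists U, [/\ is_max U, dist U X = 1%N, dist U Y = 1%N & dist U Z = 1%N].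
Proof.
move=> mX mY mZ dXY dXZ dYZ nsub.
have [J [sJ rJ XYJ XZJ minJ]] := triple_hyperplane mX mY mZ dXY dXZ dYZ nsub.
have [U mU [JU UX]] := thin_other X sJ rJ.
have JX : J `<=` X by apply: minJ => [|x []|x []] //; case: mX => -[].
have [_ dUX] := hyperplane_dist1 mU mX sJ JU JX rJ UX.
have near V : is_max V -> dist X V = 2%N -> X `&` V `<=` J -> dist U V = 1%N.
  move=> mV dXV XVJ; have := dist_odd mU mX mV; rewrite dUX dXV /=.
  have := dist_ge_cap mU mV (maxI mX mV) (subset_trans XVJ JU) (@subIsetr _ _
    _).
  by have := distP mX mV; rewrite dXV; case: (dist U V) => [|[|[|k]]] //; lia.
by exists U; split=> //; apply: near.
Qed.

Lemma triple_neighbour_uniq X Y Z U V : is_max X -> is_max Y -> is_max Z ->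
  is_max U -> is_max V ->
  dist X Y = 2%N -> dist X Z = 2%N -> dist Y Z = 2%N -> ~ (X `&` Y `<=` Z) ->
  dist U X = 1%N -> dist U Y = 1%N -> dist U Z = 1%N ->
  dist V X = 1%N -> dist V Y = 1%N -> dist V Z = 1%N -> U = V.
Proof.
move=> mX mY mZ mU mV dXY dXZ dYZ nsub dUX dUY dUZ dVX dVY dVZ.
have [J [sJ rJ XYJ XZJ minJ]] := triple_hyperplane mX mY mZ dXY dXZ dYZ nsub.
have JX : J `<=` X by apply: minJ => [|x []|x []] //; case: mX => -[].
have JP P : is_max P -> dist P X = 1%N -> dist P Y = 1%N -> dist P Z = 1%N ->
  J `<=` P.
  move=> mP dPX dPY dPZ; apply: minJ; first by case: mP => -[].
    by apply: dist_convex => //; rewrite dXY (dist_sym X) dPX dPY.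
  by apply: dist_convex => //; rewrite dXZ (dist_sym X) dPX dPZ.
apply: (thin_uniq sJ rJ mX mU mV) => //; try exact: JP.
  by move=> e; move: dUX; rewrite e dist_xx.
by move=> e; move: dVX; rewrite e dist_xx.
Qed.

(** Stated with hyperplanes instead of a base, because a neighbour of U is
    determined by the hyperplane that it shares with U. *)
Lemma independent_hyperplanes U m : is_max U -> (m <= n)%N ->
  exists h : nat -> set T,
  (forall i, (i < m)%N -> [/\ sing (h i), h i `<=` U & (rk (h i)).+1 = n]) /\
  (rk [set x | U x /\ forall i, (i < m)%N -> h i x] + m = n)%N.
Proof.
move=> mU; elim: m => [|m IH] mn.
  exists (fun=> set0); split=> //.
  have -> : [set x | U x /\ forall i, (i < 0)%N -> set0 x] = U.
    by apply/seteqP; split=> [x []|x Ux].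
  by rewrite addn0; case: mU.
have [h [hP rK]] := IH (ltnW mn).
set K := [set x | _] in rK.
have KU : K `<=` U by move=> x [].
have sU := proj1 mU.
have sK : sing K.
  apply: (sub_sing _ sU) => //; split=> [x [/(sing_pt sU)//]|x y L [Ux hx] [Uy
    hy] xy lL Lx Ly z Lz].
  split; first exact: (subspace_line (proj1 sU) Ux Uy xy lL).
  move=> i im; have [[si _] _ _] := hP i im.
  by apply: (subspace_line si (hx i im) (hy i im) xy lL).
have [|r Kr _] := @subset_ex T K set0.
  by rewrite subset0 => e; move: rK; rewrite e rk0; lia.
have [||H [sH _ HU nHr rH]] := hyperplane_avoiding sU sing0 _ (KU _ Kr);
  [by []|by []|].
have rU : rk U = n := proj2 mU.
rewrite rU in rH.
exists (fun i => if i == m then H else h i); split.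
  by move=> i; rewrite ltnS leq_eqVlt; case: eqP => [->|_ /hP].
set K' := [set x | _].
have eK : K' = K `&` H.
  apply/seteqP; split=> [x [Ux hx]|x [[Ux hx] Hx]].
    split; last by have := hx m (ltnSn m); rewrite eqxx.
    by split=> // i im; have := hx i (ltnW im); rewrite ltn_eqF.
  by split=> // i; rewrite ltnS leq_eqVlt; case: eqP => //= _ /hx.
have sKH := singI sK sH.
have := rk_cap sU sK sH KU HU; rewrite eK rU.
suff : (rk (K `&` H) < rk K)%N by lia.
rewrite ltnNge; apply/negP => le.
have e : K `&` H = K by apply: rk_eq => // x [].
by apply: nHr; move: Kr; rewrite -e => -[].
Qed.

(** The part of an apartment around U, without naming a frame: W is chosen to
    meet U in the intersection of the hyperplanes with index in s, and a
    neighbour of U is closer to W exactly when its hyperplane contains that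
    intersection. *)
Lemma neighbour_system U m : is_max U -> (m <= n)%N -> exists X : nat -> set T,
  (forall i, (i < m)%N -> is_max (X i) /\ dist (X i) U = 1%N) /\
  forall s : seq nat, uniq s -> all (gtn m) s -> exists W, [/\ is_max W,
    dist W U = size s,
    forall i, i \in s -> (dist W (X i)).+1 = size s
  & forall i, (i < m)%N -> i \notin s -> dist W (X i) = (size s).+1].
Proof.
move=> mU mn; have sU := proj1 mU; have rU := proj2 mU.
have [h [hP]] := independent_hyperplanes mU mn.
set K := [set x | _] => rK.
have /choice[X XP] i : exists Y, (i < m)%N ->
  [/\ is_max Y, Y `&` U = h i & dist Y U = 1%N].
  have [im|_] := boolP (i < m)%N; last by exists U.
  have [si hU ri] := hP i im; have [Y mY [hY YU]] := thin_other U si ri.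
  by exists Y => _; have [] := hyperplane_dist1 mY mU si hY hU ri YU.
exists X; split=> [i /XP[]//|s us ms].
pose A (s : seq nat) := [set x | U x /\ forall i, i \in s -> h i x].
have AU t : A t `<=` U by move=> x [].
have sA t : all (gtn m) t -> sing (A t).
  move=> /allP mt; apply: (sub_sing _ sU) => //; split=> [x [/(sing_pt sU)//]|].
  move=> x y L [Ux hx] [Uy hy] xy lL Lx Ly z Lz.
  split; first exact: (subspace_line (proj1 sU) Ux Uy xy lL).
  move=> i it; have [[si _] _ _] := hP i (mt i it).
  by apply: (subspace_line si (hx i it) (hy i it) xy lL).
have rcat t t' : all (gtn m) t -> all (gtn m) t' ->
    (rk (A t') <= rk (A (t ++ t')) + size t)%N.
  move=> + mt'; elim: t => [|i t IH] /=; first by rewrite addn0.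
  move=> /andP[im mt]; have := IH mt; have [si hU ri] := hP i im.
  have mc : all (gtn m) (t ++ t') by rewrite all_cat mt.
  have := rk_cap sU (sA _ mc) si (@AU _) hU.
  suff -> : A (t ++ t') `&` h i = A (i :: t ++ t') by lia.
  apply/seteqP; split=> [x [[Ux hx] hi]|x [Ux hx]].
    by split=> // j; rewrite inE => /predU1P[->|/hx].
  split; last by apply: hx; rewrite inE eqxx.
  by split=> // j jt; apply: hx; rewrite inE jt orbT.
have rA (t : seq nat) : uniq t -> all (gtn m) t -> (rk (A t) + size t = n)%N.
  move=> ut mt.
  have A0 : A [::] = U by apply/seteqP; split=> [x []|].
  have := rcat t [::] mt isT; rewrite cats0 A0 rU.
  pose t' : seq nat := [seq i <- iota 0 m | i \notin t].
  have mt' : all (gtn m) t'.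
    by apply/allP => i; rewrite mem_filter mem_iota => /andP[_].
  have := rcat t' t mt' mt.
  have -> : A (t' ++ t) = K.
    apply/seteqP; split=> x [Ux hx]; split=> // i.
      move=> im; apply: hx; rewrite mem_cat mem_filter mem_iota add0n im /=
        andbT.
      exact: orNb.
    rewrite mem_cat => /orP[it|it]; apply: hx; first exact: (allP mt').
    exact: (allP mt).
  have : (size t' + size t = m)%N.
    rewrite -size_cat -(size_iota 0 m); apply/perm_size/uniq_perm.
    - rewrite cat_uniq filter_uniq ?iota_uniq // ut andbT.
      by apply/hasPn => i it; rewrite mem_filter negb_and negbK it.
    - exact: iota_uniq.
    - move=> i; rewrite mem_cat mem_filter mem_iota add0n /=.
      by have [/(allP mt)|] := boolP (i \in t); rewrite ?orbT ?orbF.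
  lia.
have [W [mW AW WU]] := opposite_through (sA s ms) mU.
have eA : W `&` U = A s.
  by apply/seteqP; split=> // x Ax; split; [apply: AW|case: Ax].
have dWU : dist W U = size s by have := distP mW mU; have := rA s us ms;
  rewrite eA; lia.
exists W; split=> //.
  move=> i si; have [mX XU d1] := XP i (allP ms i si).
  rewrite -dWU (dist_closer mW mU mX) // ?(dist_sym U) //.
  by rewrite eA => x [_ /(_ i si)]; rewrite -XU => -[].
move=> i im nsi; have [mX XU d1] := XP i im.
rewrite -dWU (dist_farther mW mU mX) // ?(dist_sym U) //.
rewrite eA => AX.
have ms' : all (gtn m) (i :: s) by rewrite /= im.
have := rA (i :: s); have := rA s us ms; rewrite /= nsi us im => r1 /(_ isT ms).
suff -> : A (i :: s) = A s by lia.
apply/seteqP; split=> x [Ux hx]; split=> // j.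
  by move=> js; apply: hx; rewrite inE js orbT.
rewrite inE => /predU1P[->|/hx//].
by rewrite -XU; split=> //; apply: AX.
Qed.

(** * The half-spin Grassmannians *)

Context {G : bool -> set (set T)}.
Hypothesis spinG : half_spin_Grassmannians Pi n G.

Lemma spin_max b X : G b X -> is_max X.
Proof.
have [h _ _] := spinG; move=> GX; apply/GrE_max; rewrite -h.
by case: b GX; [left|right].
Qed.

Lemma spin_odd b c X Y : G b X -> G c Y -> odd (dist X Y) = (b != c).
Proof.
move=> GX GY; have [_ _ h] := spinG; have [k dk <-] := h b c X Y GX GY.
congr odd; apply: has_distance_uniq dk.
by apply: dual_distance; apply: spin_max; eassumption.
Qed.

Lemma max_spin X : is_max X -> exists b, G b X.
Proof.
have [h _ _] := spinG; move=> /GrE_max; rewrite -h.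
by case=> ?; [exists true|exists false].
Qed.

Lemma spin_class b X Y : G b X -> is_max Y -> G (b (+) odd (dist X Y)) Y.
Proof.
move=> GX /max_spin[c GY]; rewrite (spin_odd GX GY).
by move: GY {GX}; case: b; case: c.
Qed.

Lemma half_spin_distance b X Y : G b X -> G b Y ->
  has_distance (half_spin_graph Pi n (G b)) X Y (dist X Y)./2.
Proof.
move=> GX GY; split=> [|j w].
  have mX := spin_max GX.
  move e : (dist X Y)./2 => k; elim: k Y GY e => [|k IH] Y GY e;
    have mY := spin_max GY;
    have oXY := spin_odd GX GY; rewrite eqxx /= in oXY.
    have d0 : dist X Y = 0%N by move: (odd_double_half (dist X Y));
      rewrite oXY e; lia.
    by rewrite -(dist_eq0 mX mY d0); constructor.
  have d2 : dist X Y = k.*2.+2 by rewrite -(odd_double_half (dist X Y)) oXY e.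
  have [|x Xx nYx] := dist_gt0 mX mY; first by rewrite d2.
  have [Z [mZ _ _ d1 eZ]] := toward mX mY Xx nYx.
  have [|x' Xx' nZx'] := dist_gt0 mX mZ; first by lia.
  have [Z' [mZ' _ _ d1' eZ']] := toward mX mZ Xx' nZx'.
  have dk : dist X Z' = k.*2 by lia.
  have GZ' : G b Z' by have := spin_class GX mZ'; rewrite dk odd_double addbF.
  have dYZ' : dist Y Z' = 2%N.
    have := dist_triangle mY mZ mZ'; have := dist_triangle mX mZ' mY.
    by rewrite (dist_sym Z' Y); lia.
  apply: (@walk_step _ _ _ _ Z'); [by apply: IH => //;
    rewrite dk doubleK|exact: GY|].
  apply/GrE; rewrite setIC; split; first exact: maxI.
  by have := distP mY mZ'; lia.
suff : is_max Y /\ (dist X Y <= j.*2)%N by case; lia.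
have mX := spin_max GX.
elim: w mX {GX GY} => {X Y j} [X _ mX|j X Y Z _ IH /spin_max mZ /GrE[sYZ rYZ]
  mX].
  by rewrite dist_xx.
have [mY le1] := IH mX.
by split=> //; have := dist_triangle mX mY mZ; have := distP mY mZ; lia.
Qed.

End Thin.

(** * Extending the embedding to all maximal singular subspaces *)

Section Extension.
Context {T T' : Type}.
Context {n n' : nat}.
Context (Pi : thin_polar_geometry T n) (Pi' : thin_polar_geometry T' n').

Local Notation max1 := (is_max Pi).
Local Notation max2 := (is_max Pi').
Local Notation d1 := (dist Pi).
Local Notation d2 := (dist Pi').

Section HalfSpin.
Context {G : bool -> set (set T)} {delta : bool} {f : set T -> set T'}.
Hypothesis spinG : half_spin_Grassmannians Pi n G.
Hypothesis n6 : (6 <= n)%N.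
Hypothesis f_max : forall X, G delta X -> max2 (f X).
Hypothesis f_dist : forall X Y, G delta X -> G delta Y ->
  d2 (f X) (f Y) = d1 X Y.

(** The neighbours of U in G delta form a clique. The images of three of them have
    a common neighbour U'. If some member Z of the clique had an image at
    distance 3 from U', then f Z & U' = E, of rank n' - 3, would lie in the images
    of six independent members X i, because the neighbours of U' among them lie on
    geodesics from f Z to U'. Take W near X 0, X 1, X 2 only, and another W
    near X 0, ..., X 4 only: the gates of their images on E are both adjacent to
    the images of X 0, X 1, X 2, hence equal, but the first is at distance 3 from
    the image of X 3 and the second at distance 1. Six members are needed to
    have one that is far from the second W. *)
Lemma clique_neighbour U : G (~~ delta) U -> exists2 U', max2 U' &
  forall X, G delta X -> d1 X U = 1%N -> d2 (f X) U' = 1%N.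
Proof.
move=> GU; have mU := spin_max spinG GU.
have [X [XP sys]] := neighbour_system mU n6.
have odd_class W : max1 W -> odd (d1 W U) -> G delta W.
  by move=> mW; rewrite dist_sym => oW; have := spin_class spinG GU mW;
    rewrite oW addbT negbK.
have GX i : (i < 6)%N -> G delta (X i).
  by move=> i6; have [mX e] := XP i i6; apply: odd_class => //; rewrite e.
have mf i : (i < 6)%N -> max2 (f (X i)) by move=> /GX /f_max.
have W_ex (s : seq nat) : uniq s -> all (gtn 6) s -> odd (size s) ->
  exists W', [/\ max2 W',
    forall i, i \in s -> (d2 W' (f (X i))).+1 = size s
  & forall i, (i < 6)%N -> i \notin s -> d2 W' (f (X i)) = (size s).+1].
  move=> us s6 os; have [W [mW dW near far]] := sys s us s6.
  have GW : G delta W by apply: odd_class => //; rewrite dW.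
  exists (f W); split=> [|i si|i i6 si]; first exact: f_max.
    by rewrite f_dist ?near //; apply/GX/(allP s6).
  by rewrite f_dist ?far //; apply: GX.
have dX i j : (i < 6)%N -> (j < 6)%N -> i != j -> d2 (f (X i)) (f (X j)) = 2%N.
  move=> i6 j6 ij.
  have [W [mW near far]] := W_ex [:: i] isT ltac:(by rewrite /= i6) isT.
  have e0 : d2 W (f (X i)) = 0%N by have := near i (mem_head _ _); case.
  by rewrite -(dist_eq0 mW (mf i i6) e0) far // inE eq_sym.
have m0 := mf 0%N isT; have m1 := mf 1%N isT; have m2 := mf 2%N isT.
have d01 := dX 0%N 1%N isT isT isT; have d02 := dX 0%N 2%N isT isT isT.
have d12 := dX 1%N 2%N isT isT isT.
have cap_sing i j : (i < 6)%N -> (j < 6)%N ->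
  singular Pi' (f (X i) `&` f (X j)).
  by move=> /mf mi /mf mj; apply: maxI.
(* otherwise the gate on f (X 0) & f (X 1) of an image near f (X 0) and f (X 1)
   but not near f (X 2) would be both f (X 0) and f (X 1) *)
have noline : ~ (f (X 0%N) `&` f (X 1%N) `<=` f (X 2%N)).
  move=> sub; have [|||W [mW near far]] := W_ex [:: 0; 1; 3]%N => //.
  have sN := cap_sing 0%N 1%N isT isT.
  have [P [mP NP gP]] := gate mW sN.
  have g0 := gP _ m0 (fun x => @proj1 _ _);
    have g1 := gP _ m1 (fun x => @proj2 _ _).
  have g2 := gP _ m2 sub.
  have n0 := near 0%N isT; have n1 := near 1%N isT; have f2 := far 2%N isT isT.
  have := dist_ge_cap mP m2 sN NP sub; have := distP m0 m1;
    rewrite d01 /= in n0 n1 f2 *.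
  move=> e le.
  have p0 : d2 P (f (X 0%N)) = 0%N by lia.
  have p1 : d2 P (f (X 1%N)) = 0%N by lia.
  by move: d01; rewrite -(dist_eq0 mP m0 p0) p1.
have [U' [mU' u0 u1 u2]] := triple_neighbour m0 m1 m2 d01 d02 d12 noline.
exists U' => // Z GZ dZ.
have mZ := f_max GZ.
have mZ1 := spin_max spinG GZ.
have dZX i : (i < 6)%N -> (d2 (f Z) (f (X i)) <= 2)%N.
  move=> i6; rewrite f_dist //; last exact: GX.
  have [mX e] := XP i i6.
  by have := dist_triangle mZ1 mU mX; rewrite dZ (dist_sym Pi U) e.
have oddU Y : G delta Y -> odd (d2 (f Y) U').
  move=> GY; rewrite (dist_odd (f_max GY) m0 mU') (dist_sym Pi' (f (X 0%N))) u0
    addbT.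
  by rewrite f_dist ?(spin_odd spinG GY (GX 0%N isT)) ?eqxx //; apply: GX.
apply: contrapT => nU'.
have dZ3 Y : G delta Y -> (forall i, (i < 3)%N ->
  (d2 (f Y) (f (X i)) <= 2)%N) ->
    d2 (f Y) U' <> 1%N -> d2 (f Y) U' = 3%N.
  move=> GY dYX; have := oddU Y GY; have := dist_triangle (f_max GY) m0 mU'.
  have h0 := dYX 0%N isT; rewrite (dist_sym Pi' (f (X 0%N)) U') u0.
  by move: (d2 (f Y) U') => [|[|[|[|k]]]] // h1; exfalso; lia.
have sub3 Y A : G delta Y -> max2 A -> (d2 (f Y) A <= 2)%N -> d2 A U' = 1%N ->
    d2 (f Y) U' = 3%N -> f Y `&` U' `<=` A.
  move=> GY mA dYA dA dY; apply: (dist_convex (Pi := Pi')) => //;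
    first exact: f_max.
  by have := dist_triangle (f_max GY) mA mU'; lia.
pose E := f (X 0%N) `&` f (X 1%N) `&` f (X 2%N).
have rE : (rk Pi' E + 3 = n')%N by apply: triple_rank.
have sE : singular Pi' E by apply: singI; [exact: cap_sing|case: m2].
have eE Y : G delta Y -> (forall i, (i < 3)%N -> (d2 (f Y) (f (X i)) <= 2)%N) ->
    d2 (f Y) U' = 3%N -> f Y `&` U' = E.
  move=> GY dYX dY; have mY := f_max GY; apply: (rk_eq (Pi := Pi')) => //;
    first exact: maxI.
    by move=> x Yx; split; [split|]; apply: (sub3 Y) => //;
      rewrite ?(dist_sym Pi' _ U') //; apply: dYX.
  by have := distP mY mU'; lia.
have dZX3 i : (i < 3)%N -> (d2 (f Z) (f (X i)) <= 2)%N.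
  by move=> i3; apply: dZX; lia.
have d3 := dZ3 Z GZ dZX3 nU'.
have EZ := eE Z GZ dZX3 d3.
have EU : E `<=` U' by rewrite -EZ => x [].
have EX i : (i < 6)%N -> E `<=` f (X i).
  move=> i6; have [dX1|nX1] := pselect (d2 (f (X i)) U' = 1%N).
    by rewrite -EZ; apply: sub3 => //; [exact: mf|exact: dZX].
  have [i3|i3] := ltnP i 3.
    by case: i i6 i3 nX1 => [|[|[|]]] // _ _ []; rewrite dist_sym.
  have dXi j : (j < 3)%N -> (d2 (f (X i)) (f (X j)) <= 2)%N.
    by move=> j3; rewrite dX //; lia.
  by rewrite -(eE _ (GX i i6) dXi (dZ3 _ (GX i i6) dXi nX1)) => x [].
have gates (s : seq nat) : uniq s -> all (gtn 6) s -> odd (size s) ->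
  0%N \in s -> 1%N \in s ->
    2%N \in s -> 5%N \notin s -> exists P, [/\ max2 P,
    forall i, i \in s -> d2 P (f (X i)) = 1%N
  & forall i, (i < 6)%N -> i \notin s -> d2 P (f (X i)) = 3%N].
  move=> us s6 os s0 s1 s2 s5; have [W [mW near far]] := W_ex s us s6 os.
  have [P [mP EP gP]] := gate mW sE.
  have gX i : (i < 6)%N -> d2 W (f (X i)) = (d2 W P + d2 P (f (X i)))%N.
    by move=> i6; apply: gP; [exact: mf|exact: EX].
  (* the gate is not f (X 0) itself, as f (X 1) is equally near; and it is at
     distance at most 3 from f (X 5) *)
  have p0 : d2 P (f (X 0%N)) <> 0%N.
    move=> p0; have p1 : d2 P (f (X 1%N)) = 0%N.
      by have := gX 0%N isT; have := gX 1%N isT; have := near _ s0;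
        have := near _ s1; lia.
    by move: d01; rewrite -(dist_eq0 mP m0 p0) p1.
  have := dist_ge_cap mP (mf 5%N isT) sE EP (EX 5%N isT).
  have := far 5%N isT s5; have := gX 5%N isT; have := gX 0%N isT;
    have := near _ s0.
  move=> h1 h2 h3 h4 h5.
  exists P; split=> // i.
    by move=> si; have := gX i (allP s6 i si); have := near i si; lia.
  by move=> i6 si; have := gX i i6; have := far i i6 si; lia.
have [|||||||P [mP nearP farP]] := gates [:: 0; 1; 2]%N => //.
have [|||||||Q [mQ nearQ _]] := gates [:: 0; 1; 2; 3; 4]%N => //.
have PQ : P = Q.
  by apply: (triple_neighbour_uniq m0 m1 m2) => //;
    [exact: nearP|exact: nearP|exact: nearP|
    exact: nearQ|exact: nearQ|exact: nearQ].
by have := farP 3%N isT isT; rewrite PQ (nearQ 3%N isT).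
Qed.

Lemma dual_extension : exists F : set T -> set T',
  [/\ forall X, G delta X -> F X = f X, forall X, max1 X -> max2 (F X)
    & forall X Y, max1 X -> max1 Y -> d1 X Y = 1%N -> d2 (F X) (F Y) = 1%N].
Proof.
have disj X : G delta X -> ~ G (~~ delta) X.
  move=> GX GX'; have := spin_odd spinG GX GX'.
  by rewrite (dist_xx (spin_max spinG GX)); case: (delta).
have /choice[F FP] X : exists Y, [/\ max1 X -> max2 Y, G delta X -> Y = f X
    & G (~~ delta) X -> forall Z, G delta Z -> d1 Z X = 1%N ->
      d2 (f Z) Y = 1%N].
  have [GX|nGX] := pselect (G delta X).
    by exists (f X); split=> // [_|/(disj _ GX)//]; apply: f_max.
  have [GX|nGX'] := pselect (G (~~ delta) X).
    by have [U mU UP] := clique_neighbour GX; exists U; split.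
  exists (f X); split=> // /(max_spin spinG)[b GX].
  by case: nGX' ; move: nGX GX; case: (delta); case: b.
exists F; split=> [X GX|X mX|X Y mX mY dXY];
  [by case: (FP X) => _ ->|by case: (FP X) => /(_ mX)|].
have cases Z : max1 Z -> G delta Z \/ G (~~ delta) Z.
  by move=> /(max_spin spinG)[b]; case: b; case: (delta);
    [left|right|right|left].
have main A B : max1 A -> max1 B -> G delta A -> d1 A B = 1%N ->
  d2 (F A) (F B) = 1%N.
  move=> mA mB GA dAB; have [_ -> // _] := FP A; have [_ _ h] := FP B.
  by apply: h => //; have := spin_class spinG GA mB; rewrite dAB addbT.
have [GX|GX] := cases X mX; first exact: main.
rewrite dist_sym; apply: main => //; last by rewrite dist_sym.
by have := spin_class spinG GX mY; rewrite dXY addbT negbK.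
Qed.

Hypothesis even_n : ~~ odd n.
Variable F : set T -> set T'.
Hypothesis F_ext : forall X, G delta X -> F X = f X.
Hypothesis F_max : forall X, max1 X -> max2 (F X).
Hypothesis F_adj : forall X Y, max1 X -> max1 Y -> d1 X Y = 1%N ->
  d2 (F X) (F Y) = 1%N.

Lemma extension_lipschitz X Y : max1 X -> max1 Y ->
  (d2 (F X) (F Y) <= d1 X Y)%N.
Proof.
move=> mX; move e : (d1 X Y) => k; elim: k Y e => [|k IH] Y e mY.
  by rewrite (dist_eq0 mX mY e) (dist_xx (F_max mY)).
have [|x Xx nYx] := dist_gt0 mX mY; first by rewrite e.
have [Z [mZ _ _ dYZ eZ]] := toward mX mY Xx nYx.
have := IH Z ltac:(lia) mZ; have := F_adj mY mZ dYZ.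
by have := dist_triangle (F_max mX) (F_max mZ) (F_max mY);
  rewrite (dist_sym Pi' (F Z)); lia.
Qed.

Lemma neighbour_class X Y : max1 X -> max1 Y -> d1 X Y = 1%N -> ~ G delta X ->
  G delta Y.
Proof.
move=> mX mY dXY nGX; have [b GX] := max_spin spinG mX.
have := spin_class spinG GX mY; rewrite dXY addbT.
by move: nGX GX; case: (delta); case: b.
Qed.

(** If X and Y are not opposite, a neighbour Z of Y is further from X than Y is,
    and the distance of X and Z, which is kept if Z is in G delta, bounds that of
    X and Y from below. *)
Lemma extension_isometric_step X Y : max1 X -> max1 Y -> (d1 X Y < n)%N ->
  (forall Z, G delta Z -> d2 (F X) (F Z) = d1 X Z) -> d2 (F X) (F Y) = d1 X Y.
Proof.
move=> mX mY ltn h; have [/h//|nGY] := pselect (G delta Y).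
have [r [Xr Yr] _] : exists2 r, (X `&` Y) r & ~ set0 r.
  by apply: subset_ex; rewrite subset0 => e; have := distP mX mY; rewrite e rk0;
    lia.
have [Z [mZ _ nZr dYZ]] := away mY (sing0 Pi) (fun x (h : set0 x) => False_ind _
  h) Yr id.
have eZ : d1 X Z = (d1 X Y).+1 by apply: dist_farther => // /(_ r (conj Xr Yr)).
have GZ := neighbour_class mY mZ dYZ nGY.
have := h Z GZ; have := F_adj mY mZ dYZ; have := extension_lipschitz mX mY.
by have := dist_triangle (F_max mX) (F_max mY) (F_max mZ); lia.
Qed.

Lemma square_intersections A B C D k : max2 A -> max2 B -> max2 C -> max2 D ->
  d2 A B = 1%N -> d2 C D = 1%N -> d2 B C = k -> d2 A C = k.+1 ->
    d2 B D = k.+1 ->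
  d2 A D = k -> A `&` C = B `&` D.
Proof.
move=> mA mB mC mD dAB dCD dBC dAC dBD dAD.
apply: (rk_eq (Pi := Pi')); [exact: maxI|exact: maxI| |].
  have AC_D : A `&` C `<=` D.
    by apply: (dist_convex mA mD mC); rewrite (dist_sym Pi' D) dCD dAD dAC
      addn1.
  have AC_B : A `&` C `<=` B.
    by apply: (dist_convex mA mB mC); rewrite dAB dBC dAC.
  by move=> x ACx; split; [apply: AC_B|apply: AC_D].
by have := distP mA mC; have := distP mB mD; lia.
Qed.

(** A neighbour Z of X meets Y in a point, a neighbour W of Y meets Y in a
    hyperplane, and their distance n - 2 or n tells whether the point is on the
    hyperplane. If F X and F Y were at distance n - 2 only, then F Z & F Y would
    equal F X & F W for every incident pair (square_intersections). With points a
    and b, a hyperplane through both and one through a only, this makes the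
    images of the non-incident pair too close. *)
Lemma extension_isometric_opposite X Y : max1 X -> max1 Y -> ~ G delta X ->
  ~ G delta Y ->
  d1 X Y = n -> (forall A B, max1 A -> max1 B -> G delta A ->
    d2 (F A) (F B) = d1 A B) ->
  d2 (F X) (F Y) = n.
Proof.
move=> mX mY nGX nGY dXY iso.
have sY := proj1 mY.
have XY0 : forall x, X x -> ~ Y x.
  move=> x Xx Yx; suff : (X `&` Y `<=` set0) by apply; split; first exact: Xx.
  suff <- : set0 = X `&` Y by [].
  apply: (rk_eq (Pi := Pi)) => //; [exact: sing0|exact: maxI|].
  by have := distP mX mY; rewrite dXY; lia.
have point a : Y a -> exists Xa, [/\ max1 Xa, Xa a, G delta Xa, d1 Xa X = 1%N &
    d1 Xa Y = n.-1 /\ rk Pi (Xa `&` Y) = 1%N].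
  move=> Ya; have [|Xa [mXa Xaa _ dXa e]] := toward mY mX Ya.
    by move=> Xa; apply: XY0 Xa Ya.
  have dXaY : d1 Xa Y = n.-1 by rewrite (dist_sym Pi Xa);
    rewrite (dist_sym Pi Y) dXY in e; lia.
  have GXa := neighbour_class mX mXa dXa nGX; rewrite dist_sym in dXa.
  exists Xa; split=> //; split=> //.
  by have := distP mXa mY; rewrite dXaY; lia.
have [a Ya _] : exists2 a, Y a & ~ set0 a.
  apply: subset_ex; rewrite subset0 => e; have : rk Pi Y = n := proj2 mY.
  by rewrite e rk0; lia.
have [A [mA Aa GA dAX [dAY rA]]] := point a Ya.
have [b Yb nAb] : exists2 b, Y b & ~ A b.
  by apply: (dist_gt0 mY mA); rewrite dist_sym dAY; lia.
have [B [mB Bb GB dBX [dBY rB]]] := point b Yb.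
have sAY := maxI mA mY; have sBY := maxI mB mY.
have [J [sJ AJ BJ minJ rJ]] : exists J, [/\ singular Pi J, A `&` Y `<=` J,
  B `&` Y `<=` J,
   forall S, subspace Pi S -> A `&` Y `<=` S -> B `&` Y `<=` S -> J `<=` S &
   (rk Pi J + rk Pi (A `&` Y `&` (B `&` Y)) = rk Pi (A `&` Y) + rk Pi (B `&`
     Y))%N].
  by apply: join_ex => // x [_ Yx]; apply: sing_perpP sY _ Yx => y [].
have JY : J `<=` Y by apply: minJ => [|x []|x []] //; case: sY.
have [r Yr nJr] : exists2 r, Y r & ~ J r.
  apply: subset_ex => YJ; have := rkS sY sJ YJ;
    have -> : rk Pi Y = n := proj2 mY.
  lia.
have [C [mC JC _ dYC]] := away mY sJ JY Yr nJr.
have nAYb : ~ (A `&` Y) b by case.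
have [D [mD AD nDb dYD]] := away mY sAY (@subIsetr _ _ _) Yb nAYb.
have dAC : d1 A Y = (d1 A C).+1 by apply: dist_closer => //;
  apply: subset_trans JC.
have dBC : d1 B Y = (d1 B C).+1 by apply: dist_closer => //;
  apply: subset_trans JC.
have dAD : d1 A Y = (d1 A D).+1 by apply: dist_closer.
have dBD : d1 B D = (d1 B Y).+1 by apply: dist_farther => // /(_ b (conj Bb
  Yb)).
have GC := neighbour_class mY mC dYC nGY;
  have GD := neighbour_class mY mD dYD nGY.
have far Z : max1 Z -> d1 Y Z = 1%N -> d1 X Z = n.-1.
  move=> mZ dYZ; have := distP mX mZ; have := distP mX mY.
  by case: (dist_step mX mY mZ dYZ); lia.
have FX Z : max1 Z -> G delta Z -> d2 (F X) (F Z) = d1 X Z.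
  by move=> mZ GZ; rewrite dist_sym (dist_sym Pi X) iso.
apply: contrapT => nd.
have dF : d2 (F X) (F Y) = n.-2.
  have := extension_lipschitz mX mY; rewrite dXY.
  have := dist_triangle (F_max mA) (F_max mX) (F_max mY); rewrite iso // dAY.
  have := dist_odd (F_max mA) (F_max mX) (F_max mY);
    rewrite iso // dAY (F_adj mA mX dAX).
  move: nd n6; move: (d2 _ _) n => d m nd m6 /= odd_m le1 le2.
  have : d <> m.-1.
    move=> e; move: odd_m; rewrite e; case: (odd _) => //.
  lia.
have sq Z W : max1 Z -> max1 W -> G delta Z -> G delta W -> d1 Z X = 1%N ->
  d1 Y W = 1%N ->
    d1 Z Y = n.-1 -> d1 Z W = n.-2 -> F Z `&` F Y = F X `&` F W.
  move=> mZ mW GZ GW dZX dYW dZY dZW.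
  have e1 : d2 (F Z) (F Y) = n.-2.+1 by rewrite iso // dZY; lia.
  have e2 : d2 (F X) (F W) = n.-2.+1 by rewrite FX // far //; lia.
  have e3 : d2 (F Z) (F W) = n.-2 by rewrite iso.
  exact: (square_intersections (F_max mZ) (F_max mX) (F_max mY) (F_max mW)
    (F_adj mZ mX dZX) (F_adj mY mW dYW) dF e1 e2 e3).
have eAC := sq A C mA mC GA GC dAX dYC dAY ltac:(lia).
have eBC := sq B C mB mC GB GC dBX dYC dBY ltac:(lia).
have eAD := sq A D mA mD GA GD dAX dYD dAY ltac:(lia).
have sub : F B `&` F Y `<=` F D by rewrite eBC -eAC eAD => x [].
have := dist_closer (F_max mB) (F_max mY) (F_max mD) (F_adj mY mD dYD) sub.
by rewrite !iso // dBY; lia.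
Qed.

Lemma extension_isometric X Y : max1 X -> max1 Y -> d2 (F X) (F Y) = d1 X Y.
Proof.
have isoG A B : G delta A -> G delta B -> d2 (F A) (F B) = d1 A B.
  by move=> GA GB; rewrite !F_ext // f_dist.
have iso A B : max1 A -> max1 B -> G delta A -> d2 (F A) (F B) = d1 A B.
  move=> mA mB GA; have [GB|nGB] := pselect (G delta B); first exact: isoG.
  apply: extension_isometric_step => // [|Z GZ]; last exact: isoG.
  have [b GB] := max_spin spinG mB.
  have : odd (d1 A B).
    rewrite (spin_odd spinG GA GB); apply: contra_notT nGB.
    by rewrite negbK => /eqP ->.
  have := distP mA mB; move: even_n; rewrite ltn_neqAle => en e od.
  by apply/andP; split; [apply: contraNneq en => <-|lia].
move=> mX mY.
have [GX|nGX] := pselect (G delta X); first exact: iso.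
have [GY|nGY] := pselect (G delta Y).
  by rewrite dist_sym (dist_sym Pi X) iso.
have := distP mX mY => e.
have [lt|ge] := ltnP (d1 X Y) n.
  apply: extension_isometric_step => // Z GZ.
  by rewrite dist_sym (dist_sym Pi X) iso //; apply: spin_max GZ.
have dXY : d1 X Y = n by lia.
by rewrite dXY; apply: extension_isometric_opposite.
Qed.

End HalfSpin.

(** * The induced map on points *)

Section Induced.
Variable F : set T -> set T'.
Hypothesis n2 : (2 <= n)%N.
Hypothesis F_max : forall X, max1 X -> max2 (F X).
Hypothesis F_iso : forall X Y, max1 X -> max1 Y -> d2 (F X) (F Y) = d1 X Y.

Local Notation rk2 := (rk Pi').

Lemma image_rank X Y : max1 X -> max1 Y ->
  (rk2 (F X `&` F Y) + n = rk Pi (X `&` Y) + n')%N.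
Proof.
move=> mX mY; have := distP (F_max mX) (F_max mY); rewrite F_iso //.
by have := distP mX mY; lia.
Qed.

Lemma image_contains X Y W : max1 X -> max1 Y -> max1 W -> X `&` Y `<=` W ->
  F X `&` F Y `<=` F W.
Proof.
move=> mX mY mW XYW.
suff [] : max1 W /\ F X `&` F Y `<=` F W by [].
apply: (@convex_through _ _ Pi (fun W => max1 W /\ F X `&` F Y `<=` F W) X Y) =>
  //;
  try by split=> // x [].
move=> Z V Z' [mZ sZ] [mZ' sZ'] mV e; split=> // x xXY.
apply: (dist_convex (F_max mZ) (F_max mV) (F_max mZ')); first by rewrite !F_iso.
by split; [apply: sZ|apply: sZ'].
Qed.

(** The W with F X & F Y inside F W form a geodesically closed set, so F X & F Y
    depends on X & Y only. For opposite X and Y it lies in every image. *)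
Lemma common_part : exists2 M, singular Pi' M &
  (rk2 M + n = n')%N /\ forall W, max1 W -> M `<=` F W.
Proof.
have [X mX _] := max_ex (sing0 Pi).
have [Y [mY _ YX0]] := opposite_through (sing0 Pi) mX.
have e : Y `&` X = set0 by rewrite -subset0.
exists (F Y `&` F X); first by apply: maxI; apply: F_max.
split; first by have := image_rank mY mX; rewrite e rk0.
by move=> W mW; apply: image_contains => //; rewrite e.
Qed.

Lemma rk_point p : points Pi p -> singular Pi [set p] /\ rk Pi [set p] = 1%N.
Proof.
move=> ptp.
have p0 : perp Pi set0 p by split.
have n0 : ~ (set0 : set T) p by [].
have e : cone Pi p set0 = [set p].
  by apply/seteqP; split=> [x [->//|[a [L []]]]//|x ->]; apply: cone_p.
by rewrite -e; split; [apply: cone_singular|rewrite rk_cone ?rk0] => //;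
  exact: sing0.
Qed.

Section CommonPart.
Variable M : set T'.
Hypothesis sing_M : singular Pi' M.
Hypothesis rk_M : (rk2 M + n = n')%N.
Hypothesis F_M : forall W, max1 W -> M `<=` F W.

Lemma opposite_images X Y : max1 X -> max1 Y -> X `&` Y = set0 ->
  F X `&` F Y = M.
Proof.
move=> mX mY e; symmetry; apply: (rk_eq (Pi := Pi')) => //.
- by apply: maxI; apply: F_max.
- by move=> x Mx; split; apply: F_M Mx.
- by have := image_rank mX mY; rewrite e rk0; lia.
Qed.

(** The image of p is F X & F Y for any X and Y that meet in p alone. A W that
    misses p is opposite to some W' through p, whose image contains g p and
    meets F W in M. *)
Lemma point_map : exists g : T -> set T', forall p, points Pi p ->
  [/\ singular Pi' (g p), rk2 (g p) = (rk2 M).+1, M `<=` g p,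
      forall W, max1 W -> W p -> g p `<=` F W
    & forall W, max1 W -> ~ W p -> g p `&` F W `<=` M].
Proof.
suff H p : exists K, points Pi p ->
  [/\ singular Pi' K, rk2 K = (rk2 M).+1, M `<=` K,
      forall W, max1 W -> W p -> K `<=` F W
    & forall W, max1 W -> ~ W p -> K `&` F W `<=` M].
  by have [g gP] := choice H; exists g.
have [ptp|] := pselect (points Pi p); last by exists set0.
have [sp rp] := rk_point ptp.
have [X mX Xp] := max_ex sp.
have [Y [mY Yp YX]] := opposite_through sp mX.
have e : Y `&` X = [set p].
  by apply/seteqP; split=> // x xp; split; [apply: Yp|apply: Xp].
exists (F Y `&` F X) => _; split.
- by apply: maxI; apply: F_max.
- by have := image_rank mY mX; rewrite e rp; lia.
- by move=> x Mx; split; apply: F_M Mx.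
- by move=> W mW Wp; apply: image_contains => //; rewrite e => x ->.
move=> W mW nWp.
have [W' [mW' W'p W'W]] := opposite_through sp mW.
have e' : W' `&` W = set0.
  by rewrite -subset0 => x xW; apply: nWp; have := W'W x xW => <-; case: xW.
rewrite -(opposite_images mW' mW e') => x [Kx Wx]; split=> //.
by apply: (image_contains mY mX mW') Kx; rewrite e => y ->; apply: W'p.
Qed.

Lemma cone_over_M K z : singular Pi' K -> rk2 K = (rk2 M).+1 -> M `<=` K ->
  K z ->
  ~ M z -> K = cone Pi' z M.
Proof.
move=> sK rK MK Kz nMz; have zM := sing_perpP sK MK Kz.
symmetry; apply: (rk_eq (Pi := Pi')) => //; first exact: cone_singular.
  by apply: cone_min => //; case: sK.
by rewrite rk_cone // rK.
Qed.

Lemma line_over_M K1 K2 S : singular Pi' K1 -> singular Pi' K2 ->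
  singular Pi' S ->
  rk2 K1 = (rk2 M).+1 -> rk2 K2 = (rk2 M).+1 -> M `<=` K1 -> M `<=` K2 ->
  K1 `<=` S -> K2 `<=` S -> ((rk2 M).+1 < rk2 S)%N ->
  exists N, [/\ singular Pi' N, rk2 N = (rk2 M).+2, K1 `<=` N,
    K2 `<=` N & N `<=` S].
Proof.
move=> s1 s2 sS r1 r2 M1 M2 K1S K2S rS.
have [z [Sz nz zK2]] : exists z, [/\ S z, ~ K1 z & K2 z \/ K2 `<=` K1].
  have [K21|/subset_ex[z K2z nz]] := pselect (K2 `<=` K1).
    have [z Sz nz] : exists2 z, S z & ~ K1 z.
      by apply: subset_ex => SK; have := rkS sS s1 SK; lia.
    by exists z; split=> //; right.
  by exists z; split=> //; [apply: K2S|left].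
have zK1 := sing_perpP sS K1S Sz.
exists (cone Pi' z K1); split.
- exact: cone_singular.
- by rewrite rk_cone // r1.
- exact: cone_sub.
- case: zK2 => [K2z|K21]; last by apply: subset_trans K21 _; apply: cone_sub.
  have nMz : ~ M z by move=> /M1.
  rewrite (cone_over_M s2 r2 M2 K2z nMz); apply: cone_min => //.
  + by case: (cone_singular s1 zK1 nz).
  + by apply: subset_trans M1 _; apply: cone_sub.
  + exact: cone_p.
- by apply: cone_min => //; case: sS.
Qed.

Local Notation k := (n'%:Z - n%:Z)%R.
Local Notation res := (residue Pi' k M).

Lemma residue_point K : points res K <-> [/\ singular Pi' K,
  rk2 K = (rk2 M).+1 & M `<=` K].
Proof.
split=> [[/GrE[sK rK] MK]|[sK rK MK]]; first by split=> //; lia.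
by split=> //; apply/GrE; split=> //; lia.
Qed.

Lemma residue_line L : lines res L <-> exists N,
  [/\ singular Pi' N, rk2 N = (rk2 M).+2, M `<=` N & L = interval Pi' k M N].
Proof.
split=> [[N [/GrE[sN rN] MN] <-]|[N [sN rN MN ->]]].
  by exists N; split=> //; lia.
by exists N => //; split=> //; apply/GrE; split=> //; lia.
Qed.

Lemma intervalE N K : interval Pi' k M N K <-> points res K /\ K `<=` N.
Proof. by split=> [[? ? ?]|[[? ?] ?]]. Qed.

Variable g : T -> set T'.
Hypothesis gP : forall p, points Pi p ->
  [/\ singular Pi' (g p), rk2 (g p) = (rk2 M).+1, M `<=` g p,
      forall W, max1 W -> W p -> g p `<=` F W
    & forall W, max1 W -> ~ W p -> g p `&` F W `<=` M].

Lemma g_point p : points Pi p -> points res (g p).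
Proof. by move=> /gP[sg rg Mg _ _]; apply/residue_point. Qed.

Lemma g_not_sub p W : points Pi p -> max1 W -> ~ W p -> ~ (g p `<=` F W).
Proof.
move=> /gP[sg rg Mg _ far] mW nWp sub.
have gM : g p `<=` M by move=> x gx; apply: (far W mW nWp); split=> //;
  apply: sub.
by have := rkS sg sing_M gM; lia.
Qed.

Lemma g_injective p q : points Pi p -> points Pi q -> g p = g q -> p = q.
Proof.
move=> ptp ptq e; apply: contrapT => pq.
have [sp _] := rk_point ptp.
have [X mX Xp] := max_ex sp.
have [W [mW Wp nWq]] : exists W, [/\ max1 W, W p & ~ W q].
  have [Xq|nXq] := pselect (X q); last by exists X; split=> //; apply: Xp.
  have npq : ~ [set p] q by move=> /= e'; apply: pq.
  by have [W [mW Wp nWq _]] := away mX sp Xp Xq npq; exists W; split=> //;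
    apply: Wp.
by have [_ _ _ h _] := gP ptp; have := h W mW Wp; rewrite e; apply: g_not_sub.
Qed.

Lemma g_collinear p q : collinear Pi p q -> collinear res (g p) (g q).
Proof.
move=> pq; have [ptp ptq] := col_pt pq.
have [sp _] := rk_point ptp.
have [X mX [Xp Xq]] : exists2 X, max1 X & X p /\ X q.
  have [e|npq] := pselect ([set p] q).
    have [X mX Xp] := max_ex sp; exists X => //.
    by rewrite e; split; apply: Xp.
  have qp : perp Pi [set p] q by split=> // x ->.
  have [X mX CX] := max_ex (cone_singular sp qp npq).
  by exists X => //; split; apply: CX; [apply: cone_sub|apply: cone_p].
have [s1 r1 M1 h1 _] := gP ptp; have [s2 r2 M2 h2 _] := gP ptq.
have sX := proj1 (F_max mX); have rX : rk2 (F X) = n' := proj2 (F_max mX).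
have [|N [sN rN gpN gqN NX]] := line_over_M s1 s2 sX r1 r2 M1 M2 (h1 X mX Xp)
  (h2 X mX Xq).
  by lia.
exists (interval Pi' k M N); split.
- by apply/residue_line; exists N; split=> //; apply: subset_trans gpN.
- by apply/intervalE; split=> //; apply: g_point.
- by apply/intervalE; split=> //; apply: g_point.
Qed.

(** Let Z be the neighbour of some Y through q that contains p, where p is not in
    Y. Then F Z is spanned by F Y & F Z and a point of g p; were g q collinear to
    g p, it would be collinear to all of F Z and so lie in F Z, although q is not
    in Z. *)
Lemma g_not_collinear p q : points Pi p -> points Pi q -> ~ collinear Pi p q ->
  ~ collinear res (g p) (g q).
Proof.
move=> ptp ptq npq [L [/residue_line[N [sN rN MN ->]] /intervalE[_ gpN]
  /intervalE[_ gqN]]].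
have [sp _] := rk_point ptp; have [sq _] := rk_point ptq.
have [X mX Xp] := max_ex sp; have {}Xp : X p by apply: Xp.
have nXq : ~ X q by move=> Xq; apply: npq; apply: sing_col (proj1 mX) Xp Xq.
have [Y [mY Yq YX]] := opposite_through sq mX.
have {}Yq : Y q by apply: Yq.
have nYp : ~ Y p.
  by move=> Yp; have := YX p (conj Yp Xp) => /= e; apply: nXq; rewrite -e.
have [Z [mZ Zp _ dYZ _]] := toward mX mY Xp nYp.
have nZq : ~ Z q by move=> Zq; apply: npq; apply: sing_col (proj1 mZ) Zp Zq.
apply: (g_not_sub ptq mZ nZq) => y gqy.
have [s1 r1 M1 h1 f1] := gP ptp; have [s2 r2 M2 h2 _] := gP ptq.
have FYy : F Y y by apply: h2 gqy.
have [r gpr nMr] : exists2 r, g p r & ~ M r.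
  by apply: subset_ex => sub; have := rkS s1 sing_M sub; lia.
have nFYr : ~ F Y r by move=> FYr; apply: nMr; apply: (f1 Y mY nYp).
have FZr : F Z r by apply: (h1 Z mZ Zp).
have mFZ := F_max mZ; have mFY := F_max mY.
have sH := maxI mFY mFZ.
have rH := distP mFY mFZ; rewrite F_iso // dYZ in rH.
have rp : perp Pi' (F Y `&` F Z) r by apply: sing_perpP (proj1 mFZ) _ FZr => x
  [].
have nHr : ~ (F Y `&` F Z) r by case.
have eZ : cone Pi' r (F Y `&` F Z) = F Z.
  apply: (max_sub (Pi := Pi')) => //.
    by split; [exact: cone_singular|rewrite rk_cone //; lia].
  by apply: cone_min => //; case: mFZ => -[].
apply: (max_perp mFZ); have pty := sing_pt s2 gqy.
suff h : F Z `<=` perp Pi' [set y] by split=> // x /h[_ /(_ y erefl)/(col_sym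
  (Pi := Pi'))].
rewrite -eZ; apply: cone_min => //; first exact: perp_subspace.
  move=> x [FYx FZx]; split; first exact: sing_pt (proj1 mFZ) FZx.
  by move=> _ ->; apply: sing_col (proj1 mFY) FYy FYx.
split; first exact: sing_pt s1 gpr.
by move=> _ ->; apply: sing_col sN (gqN _ gqy) (gpN _ gpr).
Qed.

Lemma g_frame_preserving : frame_preserving n Pi res g.
Proof.
split=> [p|F0 [F0pt cF0 uF0]]; first exact: g_point.
split.
- by move=> _ [p F0p <-]; apply/g_point/F0pt.
- rewrite (card_eql (inj_card_eq _)) // => p q /set_mem F0p /set_mem F0q.
  by apply: g_injective; apply: F0pt.
move=> _ [p F0p <-]; have [q [[F0q npq] uq]] := uF0 p F0p.
have ptp := F0pt p F0p.
exists (g q); split.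
  by split; [exists q|apply: g_not_collinear => //; apply: F0pt].
move=> _ [[q' F0q' <-] ncol]; congr g; apply: uq; split=> //.
by move=> /g_collinear.
Qed.

Lemma interval_subspace X : max1 X -> subspace res (interval Pi' k M (F X)).
Proof.
move=> mX; split=> [K /intervalE[]//|K1 K2 L /intervalE[p1 K1X] /intervalE[p2
  K2X] K12].
move=> /residue_line[N [sN rN MN ->]] /intervalE[_ K1N] /intervalE[_ K2N].
have /residue_point[s1 r1 M1] := p1; have /residue_point[s2 r2 M2] := p2.
have sNX : singular Pi' (N `&` F X) by apply: singI => //; case: (F_max mX).
have NX : N `<=` F X.
  suff <- : N `&` F X = N by move=> x [].
  apply: (rk_eq (Pi := Pi')) => //.
  rewrite rN -r1 ltnNge; apply/negP => le.
  have sub K : K `<=` N -> K `<=` F X -> K `<=` N `&` F X.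
    by move=> KN KX x Kx; split; [apply: KN|apply: KX].
  apply: K12; transitivity (N `&` F X).
    by apply: (rk_eq (Pi := Pi')) => //; apply: sub.
  by symmetry; apply: (rk_eq (Pi := Pi')) => //; [apply: sub|rewrite r2 -r1].
by move=> K /intervalE[pK KN]; apply/intervalE; split=> //;
  apply: subset_trans NX.
Qed.

(** The points of F X that lie on members of S form a subspace V. Along a flag of
    X, each new point r raises the rank of F X & F Y (with X & Y the current
    member of the flag) by one through g r, so V ends up as F X. *)
Lemma interval_generated X S : max1 X -> subspace res S -> g @` X `<=` S ->
  interval Pi' k M (F X) `<=` S.
Proof.
move=> mX [Spt cS] gS.
have sX := proj1 mX; have sFX := proj1 (F_max mX).
pose V := [set v | exists K, [/\ S K, K `<=` F X & K v]].
have uV : subspace Pi' V.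
  split=> [v [K [SK _ Kv]]|v1 v2 L [K1 [S1 K1X K1v]] [K2 [S2 K2X K2v]] v12 lL L1
    L2 z Lz].
    by have /residue_point[sK _ _] := Spt K SK; apply: sing_pt sK Kv.
  have p1 := Spt K1 S1; have p2 := Spt K2 S2.
  have /residue_point[s1 r1 M1] := p1; have /residue_point[s2 r2 M2] := p2.
  have [K12|K12] := pselect (K1 = K2).
    exists K1; split=> //; apply: (subspace_line (proj1 s1) K1v _ v12 lL) => //.
    by rewrite K12.
  have [|N [sN rN N1 N2 NX]] := line_over_M s1 s2 sFX r1 r2 M1 M2 K1X K2X.
    by have : rk2 (F X) = n' := proj2 (F_max mX); lia.
  have Nz : N z by apply: (subspace_line (proj1 sN) (N1 _ K1v) (N2 _ K2v) v12
    lL).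
  have [Mz|nMz] := pselect (M z); first by exists K1; split=> //; apply: M1.
  have MN := subset_trans M1 N1.
  have zM := sing_perpP sN MN Nz.
  have CN : cone Pi' z M `<=` N by apply: cone_min => //; case: sN.
  exists (cone Pi' z M); split; [|exact: subset_trans NX|exact: cone_p].
  apply: (cS K1 K2 (interval Pi' k M N)) => //.
  - by apply/residue_line; exists N.
  - by apply/intervalE.
  - by apply/intervalE.
  - apply/intervalE; split=> //; apply/residue_point; split.
    + exact: cone_singular.
    + by rewrite rk_cone.
    + exact: cone_sub.
have VX v : V v -> F X v by move=> [K [_ KX /KX]].
have MV : M `<=` V.
  have [x Xx _] : exists2 x, X x & ~ set0 x.
    apply: subset_ex; rewrite subset0 => e; have : rk Pi X = n := proj2 mX.
    by rewrite e rk0; lia.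
  have [_ _ Mg gX _] := gP (sing_pt sX Xx).
  by move=> z /Mg gz; exists (g x); split=> //; [apply: gS; exists x|apply: gX].
have grow j A Y : singular Pi A -> rk Pi A = j -> max1 Y -> X `&` Y = A ->
    F X `&` F Y `<=` V.
  elim: j A Y => [|j IH] A Y sA rA mY eA.
    have A0 : set0 = A.
      by apply: (rk_eq (Pi := Pi)) => //; [exact: sing0|rewrite rA].
    by rewrite opposite_images // eA.
  have AX : A `<=` X by rewrite -eA => x [].
  have AY : A `<=` Y by rewrite -eA => x [].
  have [r Ar _] : exists2 r, A r & ~ set0 r.
    by apply: subset_ex; rewrite subset0 => e; move: rA; rewrite e rk0.
  have [A' [sA' _ A'A nA'r rA']] :=
    hyperplane_avoiding sA (sing0 Pi) (fun x (h : set0 x) => False_ind _ h) Ar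
      id.
  have [Y' [mY' A'Y' Y'X]] := opposite_through sA' mX.
  have eA' : X `&` Y' = A'.
    apply/seteqP; split=> [x [Xx Y'x]|x A'x]; first exact: Y'X.
    by split; [apply/AX/A'A|apply: A'Y'].
  have IH' := IH A' Y' sA' ltac:(lia) mY' eA'.
  have Xr := AX r Ar; have Yr := AY r Ar.
  have nY'r : ~ Y' r by move=> Y'r; apply: nA'r; rewrite -eA'.
  have [sg rg Mg gX farg] := gP (sing_pt sX Xr).
  have [t gt nMt] : exists2 t, g r t & ~ M t.
    by apply: subset_ex => sub; have := rkS sg sing_M sub; lia.
  have Bt : (F X `&` F Y) t by split; [apply: (gX X mX Xr)|apply: (gX Y mY Yr)].
  have nB't : ~ (F X `&` F Y') t by move=> [_ Y't]; apply: nMt;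
    apply: (farg Y' mY' nY'r).
  have sB := maxI (F_max mX) (F_max mY); have sB' := maxI (F_max mX) (F_max
    mY').
  have B'B : F X `&` F Y' `<=` F X `&` F Y.
    move=> x B'x; split; first by case: B'x.
    by apply: (image_contains mX mY' mY) B'x; rewrite eA';
      apply: subset_trans AY.
  have tB' := sing_perpP sB B'B Bt.
  have <- : cone Pi' t (F X `&` F Y') = F X `&` F Y.
    apply: (rk_eq (Pi := Pi')) => //; first exact: cone_singular.
      by apply: cone_min => //; case: sB.
    rewrite rk_cone //; have := image_rank mX mY; have := image_rank mX mY'.
    by rewrite eA eA' rA; lia.
  apply: cone_min => //; exists (g r); split=> //; last exact: gX.
  by apply: gS; exists r.
move=> K /intervalE[pK KX].
have /residue_point[sK rK MK] := pK.
have [t Kt nMt] : exists2 t, K t & ~ M t.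
  by apply: subset_ex => sub; have := rkS sK sing_M sub; lia.
have [K' [SK' _ K't]] : V t.
  apply: (grow n X X) => //; [by case: mX|by rewrite setIid|].
  by split; apply: KX.
have /residue_point[sK' rK' MK'] := Spt K' SK'.
by rewrite (cone_over_M sK rK MK Kt nMt) -(cone_over_M sK' rK' MK' K't nMt).
Qed.

Lemma g_spans X : max1 X -> interval Pi' k M (F X) = spanned res (g @` X).
Proof.
move=> mX; apply/seteqP; split=> [K KX S [uS gS]|].
  exact: interval_generated KX.
apply: smallest_sub; first exact: interval_subspace.
move=> _ [p Xp <-]; have ptp := sing_pt (proj1 mX) Xp.
apply/intervalE; split; first exact: g_point.
by have [_ _ _ h _] := gP ptp; apply: h.
Qed.

End CommonPart.

Lemma isometry_induced : exists2 M, Gr Pi' (n'%:Z - n%:Z - 1)%R M &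
  exists2 g, frame_preserving n Pi (residue Pi' (n'%:Z - n%:Z)%R M) g &
  forall X, max1 X -> M `<=` F X /\
    interval Pi' (n'%:Z - n%:Z)%R M (F X) = spanned (residue Pi' (n'%:Z -
      n%:Z)%R M) (g @` X).
Proof.
have [M sM [rM FM]] := common_part.
have [g gP] := point_map sM rM FM.
exists M; first by apply/GrE; split=> //; lia.
exists g; first exact: g_frame_preserving.
move=> X mX; split; first exact: FM.
exact: g_spans.
Qed.

End Induced.

End Extension.

Local Open Scope ring_scope.

Theorem theorem7p2 (T T' : Type)
  (Pi : point_line_space T) (Pi' : point_line_space T') (n n' : nat)
  (G : bool -> set (set T)) (G' : bool -> set (set T')) (delta gamma : bool)
  (f : set T -> set T') :
  polar_space_of_type_D Pi n ->
  polar_space_of_type_D Pi' n' ->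
  half_spin_Grassmannians Pi n G ->
  half_spin_Grassmannians Pi' n' G' ->
  (4 <= n')%N ->
  (6 <= n)%N -> ~~ odd n ->
  isometric_embedding (half_spin_graph Pi n (G delta))
    (half_spin_graph Pi' n' (G' gamma)) f ->
  exists2 M : set T', Gr Pi' (n'%:Z - n%:Z - 1) M &
    exists2 g : T -> set T',
      frame_preserving n Pi (residue Pi' (n'%:Z - n%:Z) M) g &
      induced_by (G delta) Pi' (n'%:Z - n%:Z) M f g.
Proof.
move=> [polarPi rankPi thinPi] [polarPi' rankPi' thinPi'] spinG spinG' _ n6
  even_n.
move=> [[f_vert _ _] f_graph].
pose D := ThinPolarGeometry (geometry := PolarGeometry polarPi rankPi) thinPi.
pose D' := ThinPolarGeometry (geometry := PolarGeometry polarPi' rankPi')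
  thinPi'.
have f_max X : G delta X -> is_max D' (f X).
  by move=> /f_vert; apply: (spin_max (Pi := D')).
have f_dist X Y : G delta X -> G delta Y -> dist D' (f X) (f Y) = dist D X Y.
  move=> GX GY; have GX' := f_vert X GX; have GY' := f_vert Y GY.
  have := half_spin_distance (Pi := D) spinG GX GY.
  move=> /(f_graph X Y _ GX GY); have := half_spin_distance (Pi := D') spinG'
    GX' GY'.
  move=> h1 h2; have e := has_distance_uniq h1 h2.
  rewrite -(odd_double_half (dist D' _ _)) -(odd_double_half (dist D X Y)) e.
  by rewrite (spin_odd (Pi := D') spinG' GX' GY') (spin_odd (Pi := D) spinG GX
    GY) !eqxx.
have [F [F_ext F_max F_adj]] := dual_extension (Pi := D) (Pi' := D') spinG n6
  f_max f_dist.
have F_iso := extension_isometric (Pi := D) (Pi' := D') spinG n6 f_dist even_n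
  F_ext F_max F_adj.
have [|M GM [g gfr gsp]] := isometry_induced (Pi := D) (Pi' := D') _ F_max
  F_iso.
  by apply: leq_trans n6.
exists M => //; exists g => // X GX.
by rewrite -F_ext //; apply: gsp; apply: (spin_max (Pi := D)) GX.
Qed.
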